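(* Let $G=\langle A,B\rangle$ be a discrete free Fuchsian group of rank two, acting on the unit disc $\Delta$, without parabolic elements, such that the axes of $A$ and $B$ intersect. Let $p$ be the intersection point of the axes of $A$ and $B$, let $E$ be the elliptic Möbius transformation of order two that leaves $\Delta$ invariant and fixes $p$, and let $E_A,E_B$ be the elliptic transformations of order two defined by $A=E\circ E_A$ and $B=E\circ E_B$. Let $(p,q)$, $(p_A,q_A)$, $(p_B,q_B)$ be the respective pairs of fixed points in $\hat{\mathbb C}$ of $E,E_A,E_B$. Then the projections of these six points under $\Omega(G)\to\Omega(G)/G=S$ onto the surface $S$ of genus $2$ are the Weierstrass points of $S$.
   Context: $\Delta=\{|z|<1\}$ with its hyperbolic metric. A Fuchsian group here is a discrete group of Möbius transformations of $\hat{\mathbb C}$ leaving $\Delta$ invariant. $\Omega(G)\subset\hat{\mathbb C}$ is the set where $G$ acts discontinuously. The axis of a hyperbolic element is the geodesic in $\Delta$ joining its fixed points. The points $p,p_A,p_B$ lie in $\Delta$ and $q,q_A,q_B$ are their reflections in $\partial\Delta$. $S=\Omega(G)/G$ is the Schottky double (the conformal double of $\Delta/G$), a compact Riemann surface of genus two. The Weierstrass points of a compact Riemann surface of genus two are the six fixed points of its hyperelliptic involution (the unique conformal involution with six fixed points). *)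

(* Defs.v *)
From HB Require Import structures.
From mathcomp Require Import all_boot all_order all_algebra.
From mathcomp Require Import all_classical all_reals all_analysis.
From mathcomp Require Import complex.

Set Implicit Arguments.
Unset Strict Implicit.
Unset Printing Implicit Defensive.

Import Order.TTheory GRing.Theory Num.Theory.
Import numFieldNormedType.Exports.

Local Open Scope classical_set_scope.
Local Open Scope ring_scope.

(* Going through a numClosedFieldType makes the normed-module topology of the
   complex numbers available; it is not inferred on R[i] itself. *)
Definition Cplx (R : realType) : numClosedFieldType := R[i]%C.

(* The Riemann sphere: Some z is the finite point z, None is infinity. *)
Notation sphere R := (one_point_compactification (Cplx R)).

(* On Cplx R the order is the partial one: x <= y means that y - x is a
   nonnegative real, and the norm `|z| is a nonnegative real complex number. *)
Definition disc (R : realType) : set (sphere R) :=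
  Some @` [set z : Cplx R | `|z| < 1].
Arguments disc : clear implicits.

(** Moebius transformations *)

(* Meaningful when M is invertible. *)
Definition mobius (R : realType) (M : 'M[Cplx R]_2) (z : sphere R) : sphere R :=
  let a := M ord0 ord0 in let b := M ord0 ord_max in
  let c := M ord_max ord0 in let d := M ord_max ord_max in
  match z with
  | Some x => if c * x + d == 0 then None else Some ((a * x + b) / (c * x + d))
  | None => if c == 0 then None else Some (a / c)
  end.

Definition is_mobius (R : realType) (f : sphere R -> sphere R) : Prop :=
  exists M : 'M[Cplx R]_2, M \in unitmx /\ f = mobius M.

Definition fixpoints (T : Type) (f : T -> T) : set T := [set z | f z = z].

(* The type of a transformation other than the identity is read off from the
   squared trace of a representative of determinant 1; the inequalities below
   force this squared trace to be real. *)
Definition hyperbolic (R : realType) (f : sphere R -> sphere R) : Prop :=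
  exists M : 'M[Cplx R]_2, [/\ \det M = 1, 4 < (\tr M) ^+ 2 & f = mobius M].

Definition parabolic (R : realType) (f : sphere R -> sphere R) : Prop :=
  f <> idfun /\
  exists M : 'M[Cplx R]_2, [/\ \det M = 1, (\tr M) ^+ 2 = 4 & f = mobius M].

Definition elliptic (R : realType) (f : sphere R -> sphere R) : Prop :=
  exists M : 'M[Cplx R]_2,
    [/\ \det M = 1, 0 <= (\tr M) ^+ 2 < 4 & f = mobius M].

Definition elliptic_order_two (R : realType) (f : sphere R -> sphere R) :
    Prop :=
  [/\ elliptic f, f <> idfun & f \o f = idfun].

(** Groups of transformations *)

Definition is_group (T : Type) (G : set (T -> T)) : Prop :=
  [/\ G idfun,
      forall g h, G g -> G h -> G (g \o h) &
      forall g h, cancel g h -> cancel h g -> G g -> G h].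

Definition generated (T : Type) (X : set (T -> T)) : set (T -> T) :=
  smallest (@is_group T) X.

(* A letter (i, e) stands for the generator C (i = true) or D (i = false),
   inverted when e = true. *)
Definition word := seq (bool * bool).

Definition reduced : pred word :=
  sorted (fun k l : bool * bool => ~~ ((k.1 == l.1) && (k.2 != l.2))).

Definition eval_word (T : Type) (C C' D D' : T -> T) (w : word) : T -> T :=
  foldr (fun (l : bool * bool) f =>
           (if l.1 then if l.2 then C' else C else if l.2 then D' else D) \o f)
        idfun w.

Definition free_rank_two (T : Type) (G : set (T -> T)) : Prop :=
  exists C C' D D' : T -> T,
    [/\ cancel C C' /\ cancel C' C, cancel D D' /\ cancel D' D,
        G = generated [set C; D] &
        forall w, reduced w -> w != [::] -> eval_word C C' D D' w <> idfun].

(* The identity is isolated in the image of G in PSL(2, C). *)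
Definition discrete (R : realType) (G : set (sphere R -> sphere R)) : Prop :=
  exists2 e : Cplx R, 0 < e &
    forall M : 'M[Cplx R]_2, \det M = 1 ->
      (forall i j, `|M i j - 1%:M i j| < e) -> G (mobius M) ->
      mobius M = idfun.

Definition fuchsian (R : realType) (G : set (sphere R -> sphere R)) : Prop :=
  [/\ is_group G,
      forall g, G g -> is_mobius g,
      forall g, G g -> g @` disc R = disc R &
      discrete G].

(** Hyperbolic geometry of the disc *)

(* The distance of the metric 2|dz| / (1 - |z|^2), in closed form. *)
Definition hyp_dist (R : realType) (z w : Cplx R) : R :=
  let r := Normc.normc (z - w) / Normc.normc (1 - w^* * z) in
  ln ((1 + r) / (1 - r)).

(* A complete geodesic of the disc, parametrized by arc length. *)
Definition geodesic (R : realType) (gamma : R -> Cplx R) : Prop :=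
  (forall t, `|gamma t| < 1) /\
  (forall s t, hyp_dist (gamma s) (gamma t) = `|s - t|).

Definition axis (R : realType) (f : sphere R -> sphere R) : set (sphere R) :=
  [set z | exists (gamma : R -> Cplx R) (u v : Cplx R),
     [/\ fixpoints f = [set Some u; Some v],
         geodesic gamma,
         gamma t @[t --> -oo] --> u,
         gamma t @[t --> +oo] --> v &
         exists t, z = Some (gamma t)]].

(** The quotient of the set of discontinuity *)

Definition Omega (R : realType) (G : set (sphere R -> sphere R)) :
    set (sphere R) :=
  [set z | exists2 U : set (sphere R), nbhs z U &
     finite_set [set g | G g /\ g @` U `&` U !=set0]].

Definition group_orbit (T : Type) (G : set (T -> T)) (z : T) : set T :=
  [set g z | g in G].

(* The points of Omega(G)/G are orbits, and z projects to group_orbit G z. *)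
Definition quotient_surface (R : realType) (G : set (sphere R -> sphere R)) :
    set (set (sphere R)) :=
  group_orbit G @` Omega G.

Definition sphere_inv (R : realType) (z : sphere R) : sphere R :=
  match z with
  | Some x => if x == 0 then None else Some x^-1
  | None => Some 0
  end.

Definition finite_part (R : realType) (z : sphere R) : Cplx R :=
  match z with Some x => x | None => 0 end.

(* Complex differentiability at z in the two standard charts of the sphere,
   z and 1/z. Each of idfun and sphere_inv is its own inverse, which is why c
   also serves as the inverse of the chart c. *)
Definition holomorphic_at (R : realType) (f : sphere R -> sphere R)
    (z : sphere R) : Prop :=
  {for z, continuous f} /\
  forall c d : sphere R -> sphere R,
    [set idfun; @sphere_inv R] c -> [set idfun; @sphere_inv R] d ->
    c z <> None -> d (f z) <> None ->
    derivable (fun x : Cplx R => finite_part (d (f (c (Some x)))))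
              (finite_part (c z)) 1.

(* For G acting freely on Omega(G), the charts of Omega(G)/G are the local
   inverses of the projection; f below is the expression of J in such charts
   around the orbits of z and of f z. *)
Definition holomorphic_quotient (R : realType)
    (G : set (sphere R -> sphere R)) (J : set (sphere R) -> set (sphere R)) :
    Prop :=
  forall z, Omega G z ->
    exists (U : set (sphere R)) (f : sphere R -> sphere R),
      [/\ open U /\ U z, U `<=` Omega G, f @` U `<=` Omega G,
          forall w, U w -> holomorphic_at f w &
          forall w, U w -> J (group_orbit G w) = group_orbit G (f w)].

Definition conformal_involution (R : realType)
    (G : set (sphere R -> sphere R)) (J : set (sphere R) -> set (sphere R)) :
    Prop :=
  [/\ set_fun (quotient_surface G) (quotient_surface G) J,
      forall x, quotient_surface G x -> J (J x) = x &
      holomorphic_quotient G J].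

Definition surface_fixpoints (R : realType)
    (G : set (sphere R -> sphere R)) (J : set (sphere R) -> set (sphere R)) :
    set (set (sphere R)) :=
  quotient_surface G `&` fixpoints J.

Definition hyperelliptic_involution (R : realType)
    (G : set (sphere R -> sphere R)) (J : set (sphere R) -> set (sphere R)) :
    Prop :=
  conformal_involution G J /\ (surface_fixpoints G J #= `I_6)%card.

(* Meant for groups G whose quotient_surface is a compact surface of genus two;
   by the classical theory such a surface has exactly one hyperelliptic
   involution, so that at most one set W satisfies this. *)
Definition weierstrass_points (R : realType)
    (G : set (sphere R -> sphere R)) (W : set (set (sphere R))) : Prop :=
  exists2 J, hyperelliptic_involution G J & W = surface_fixpoints G J.

(* Main.v *)
(* Write f for any of the three half-turns E, EA, EB. Since E fixes a point
   of the axis of A, it exchanges the end points of the axis; so does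
   EA = E A, and a Moebius map exchanging two points is an involution (likewise
   for EB). G consists of the words of even length in E, EA, EB, so E
   normalizes G and induces an involution J of the orbits in Omega(G).

   A and B generate a free group of rank two, so they are free generators
   (Mal'cev's argument), whence E, EA, EB satisfy no relation other than f^2 = 1.
   An orbit G z is fixed by J iff some word of odd length fixes z. Powers of a
   cyclically reduced word of length at least two are pairwise distinct, and
   only finitely many elements of G fix a point of Omega(G); hence the word is a
   conjugate of a single letter, and z is in the orbit of one of the six points.
   The number of occurrences of each letter in a relation is even, which
   separates the orbits of fixed points of different half-turns; the two fixed
   points of one half-turn lie on different sides of the unit circle. *)
From mathcomp Require Import fingroup perm.
Require Import Defs.
From HB Require Import structures.
From mathcomp Require Import all_boot all_order all_algebra.
From mathcomp Require Import all_classical all_reals all_analysis.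
From mathcomp Require Import complex.
From mathcomp Require Import ring lra zify.

Set Implicit Arguments.
Unset Strict Implicit.
Unset Printing Implicit Defensive.

Import Order.TTheory GRing.Theory Num.Theory.
Import numFieldNormedType.Exports.

Local Open Scope classical_set_scope.
Local Open Scope ring_scope.

(** * Words in involutions *)

(** The hypothesis of freeness gives some free generators [C] and [D], with no stated link to [A]
    and [B]. Relations are therefore compared in finite permutation groups: a nontrivial reduced
    word in three involutions acts nontrivially on some finite set, while a relation between [A] and
    [B] would have to hold there.

    The analysis of fixed points is then purely combinatorial. Of Omega(G) it retains invariance
    under the half-turns and finiteness of stabilizers, so points of Omega(G) on the unit circle
    need no separate treatment.

    The axis is known only as the trace of a curve parametrized by arc length. That a half-turn
    about one of its points exchanges its ends comes from an algebraic relation between two points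
    and their hyperbolic midpoint. The relation survives passage to the limit along the curve, and
    for a fixed midpoint it is the graph of the half-turn. *)

Section WordEvaluation.
Variables (K : eqType) (inv : K -> K).
Hypothesis invK : involutive inv.

Definition ev (T : Type) (f : K -> T -> T) (w : seq K) : T -> T :=
  foldr (fun k g => f k \o g) idfun w.

(** With [letter_inv] for [inv] these are the reduced words of a free group; with [id], those of a
    free product of groups of order two. Both cases are used. *)
Definition freely_reduced : pred (seq K) := sorted (fun k l => l != inv k).

Definition push (k : K) (w : seq K) : seq K :=
  if w is l :: w' then if l == inv k then w' else k :: w else [:: k].

Definition normal_form : seq K -> seq K := foldr push [::].

Lemma freely_reduced_behead k w : freely_reduced (k :: w) -> freely_reduced w.
Proof. by case: w => //= l w /andP[]. Qed.

Lemma freely_reduced_cons2 k l w :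
  freely_reduced (k :: l :: w) = (l != inv k) && freely_reduced (l :: w).
Proof. by []. Qed.

Lemma push_reduced k w : freely_reduced w -> freely_reduced (push k w).
Proof.
case: w => [|l w] //= rw; case: eqP => [_|/eqP nl].
  exact: freely_reduced_behead rw.
by rewrite freely_reduced_cons2 nl.
Qed.

Lemma normal_form_reduced w : freely_reduced (normal_form w).
Proof. by elim: w => //= k w; exact: push_reduced. Qed.

Section Evaluation.
Variables (T : Type) (f : K -> T -> T).

Lemma ev_cat u v : ev f (u ++ v) = ev f u \o ev f v.
Proof. by elim: u => //= k u ->. Qed.

Hypothesis fK : forall k, cancel (f (inv k)) (f k).

Lemma ev_normal_form w : ev f (normal_form w) = ev f w.
Proof.
elim: w => //= k w <-; case: (normal_form w) => [|l u] //=.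
case: eqP => // -> /=; apply/funext => z /=; by rewrite fK.
Qed.

Definition word_inv (w : seq K) := rev (map inv w).

Lemma ev_invK w : cancel (ev f w) (ev f (word_inv w)).
Proof.
elim: w => [|k w IH] z //=.
rewrite /word_inv /= rev_cons -cats1 ev_cat /=.
by have := fK (inv k); rewrite invK => ->; exact: IH.
Qed.

Lemma word_invK w : word_inv (word_inv w) = w.
Proof.
by rewrite /word_inv map_rev revK -map_comp map_id_in// => k _ /=; exact: invK.
Qed.

Lemma ev_Kinv w : cancel (ev f (word_inv w)) (ev f w).
Proof. by rewrite -{2}(word_invK w); exact: ev_invK. Qed.

Lemma ev_inj w : injective (ev f w).
Proof. exact: can_inj (ev_invK w). Qed.

End Evaluation.
End WordEvaluation.

Definition letter_inv (l : bool * bool) : bool * bool := (l.1, ~~ l.2).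

Lemma letter_invK : involutive letter_inv.
Proof. by case=> i e; rewrite /letter_inv /= negbK. Qed.

Lemma reducedE w : reduced w = freely_reduced letter_inv w.
Proof.
rewrite /reduced /freely_reduced; case: w => //= k w.
elim: w k => //= l w IH k; rewrite IH; congr (_ && _).
by rewrite /letter_inv; case: k l => [[] []] [[] []].
Qed.

Definition letter (T : Type) (C C' D D' : T -> T) (l : bool * bool) : T -> T :=
  if l.1 then if l.2 then C' else C else if l.2 then D' else D.

Lemma eval_wordE T (C C' D D' : T -> T) w :
  eval_word C C' D D' w = ev (letter C C' D D') w.
Proof. by []. Qed.

Section FreeWords.
Variables (T : Type) (C C' D D' : T -> T).
Hypotheses (CK : cancel C C') (C'K : cancel C' C).
Hypotheses (DK : cancel D D') (D'K : cancel D' D).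

Lemma letterK k : cancel (letter C C' D D' (letter_inv k)) (letter C C' D D' k).
Proof. by case: k => [[] []]. Qed.

Lemma generated_words : generated [set C; D] = range (eval_word C C' D D').
Proof.
have Wgrp : is_group (range (eval_word C C' D D')).
  split; first by exists [::].
  - move=> _ _ [u _ <-] [v _ <-]; exists (u ++ v) => //.
    by rewrite !eval_wordE ev_cat.
  - move=> g h gh hg [u _ ug]; exists (word_inv letter_inv u) => //.
    rewrite eval_wordE; apply/funext => z; rewrite -{1}(hg z) -{1}ug.
    by rewrite ev_invK //; [exact: letter_invK|exact: letterK].
apply/seteqP; split.
  apply: smallest_sub => // _ [->|->].
    by exists [:: (true, false)].
  by exists [:: (false, false)].
move=> _ [w _ <-] H [Hgrp HX]; have [H1 HM HV] := Hgrp.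
have HC : H C by apply: HX; left.
have HD : H D by apply: HX; right.
elim: w => //= k w IH; apply: HM => //.
by case: k => [[] []] //=; [exact: HV C'K HC|exact: HV D'K HD].
Qed.

Section Substitution.
Variables a b : word.
Let f := letter C C' D D'.

(** [letter] merely selects one of four words here: its arguments are constant maps, evaluated at
    [[::]]. *)
Definition subst_word (w : word) : word :=
  flatten [seq letter (fun=> a) (fun=> word_inv letter_inv a)
                      (fun=> b) (fun=> word_inv letter_inv b) k [::] | k <- w].

Lemma ev_subst w : ev f (subst_word w) =
  ev (letter (ev f a) (ev f (word_inv letter_inv a))
             (ev f b) (ev f (word_inv letter_inv b))) w.
Proof.
elim: w => //= k w IH; rewrite /subst_word /= ev_cat -/(subst_word w) IH.
by case: k => [[] []].
Qed.

End Substitution.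
End FreeWords.

(* Mal'cev: in the finite set of pairs of permutations, substituting the words
   a, b for the generators is injective because c, d give an inverse
   substitution; hence it is onto, so that every relation between A and B
   holds for all pairs of permutations. *)
Lemma hopf (T : Type) (C C' D D' A A' B B' : T -> T) :
  cancel C C' -> cancel C' C -> cancel D D' -> cancel D' D ->
  (forall w, reduced w -> w != [::] -> eval_word C C' D D' w <> idfun) ->
  cancel A A' -> cancel A' A -> cancel B B' -> cancel B' B ->
  generated [set A; B] = generated [set C; D] ->
  forall u, eval_word A A' B B' u = idfun ->
  forall (X : finType) (s t : {perm X}),
    eval_word s (s^-1)%g t (t^-1)%g u = idfun.
Proof.
move=> CK C'K DK D'K free AK A'K BK B'K genE u uAB X s t.
pose pf (x y : {perm X}) := letter x (x^-1)%g y (y^-1)%g.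
have pfK x y k : cancel (pf x y (letter_inv k)) (pf x y k).
  by apply: letterK; [exact: permK|exact: permKV|exact: permK|exact: permKV].
have pinj x y w := ev_inj letter_invK (pfK x y) (w := w).
pose pw x y w := perm (@pinj x y w).
have pwE x y w : pw x y w = ev (pf x y) w :> (X -> X).
  by apply/funext => z; rewrite permE.
have pwV x y w : ((pw x y w)^-1)%g = ev (pf x y) (word_inv letter_inv w) :> (X -> X).
  apply/funext => z; apply: (@perm_inj _ (pw x y w)).
  by rewrite permKV pwE ev_Kinv //; exact: letter_invK.
pose fC := letter C C' D D'.
have fCK k : cancel (fC (letter_inv k)) (fC k) by exact: letterK.
(* Freeness of [C] and [D]: a word trivial on them has empty normal form, hence is trivial on every
   pair of permutations. *)
have relC w : ev fC w = idfun -> forall x y, ev (pf x y) w = idfun.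
  move=> w1 x y; rewrite -(ev_normal_form (pfK x y)).
  move: w1; rewrite -(ev_normal_form fCK).
  have := @normal_form_reduced _ letter_inv w.
  case: (normal_form letter_inv w) => [|k v] // rv v1.
  by case: (free (k :: v)) => //; rewrite reducedE.
have subE x y a b w :
    ev (pf x y) (subst_word a b w) = ev (pf (pw x y a) (pw x y b)) w.
  by rewrite ev_subst /pf !pwE !pwV.
have CDG : generated [set C; D] C /\ generated [set C; D] D.
  by rewrite (generated_words CK C'K DK D'K); split;
    [exists [:: (true, false)]|exists [:: (false, false)]].
have ABG : generated [set A; B] A /\ generated [set A; B] B.
  by rewrite (generated_words AK A'K BK B'K); split;
    [exists [:: (true, false)]|exists [:: (false, false)]].
move: CDG; rewrite -genE (generated_words AK A'K BK B'K).
case=> -[c _ cE] [d _ dE].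
move: ABG; rewrite genE (generated_words CK C'K DK D'K).
case=> -[a _ aE] [b _ bE].
have invU w (g g' : T -> T) : ev fC w = g -> cancel g' g ->
    ev fC (word_inv letter_inv w) = g'.
  move=> wg gK; apply/funext => z; rewrite -{1}(gK z) -wg.
  by rewrite ev_invK//; exact: letter_invK.
have abE w : ev fC (subst_word a b w) = eval_word A A' B B' w.
  rewrite ev_subst eval_wordE.
  by rewrite (invU a _ _ aE A'K) (invU b _ _ bE B'K) -/(ev _ _) -!eval_wordE aE bE.
(* If [w] expresses the generator [k] through [A] and [B], then substituting [a] and [b] in [w]
   gives back [k] up to a relation of the free group, which [relC] carries over to permutations. *)
have gen x y k (w : word) (e : {perm X}) : fC k = eval_word A A' B B' w ->
    pf x y k = e -> pw (pw x y a) (pw x y b) w = e.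
  move=> kw ke; apply/perm.permP => z; rewrite pwE -subE.
  have /relC/(_ x y) : ev fC (subst_word a b w ++ [:: letter_inv k]) = idfun.
    rewrite ev_cat abE -kw; apply/funext => r /=; exact: fCK.
  rewrite ev_cat /= => /(congr1 (fun g => g (e z))) /=.
  by rewrite -{1}ke; have := pfK x y (letter_inv k); rewrite letter_invK => ->.
have gC := fun x y => gen x y (true, false) c x (esym cE) erefl.
have gD := fun x y => gen x y (false, false) d y (esym dE) erefl.
pose Phi (xy : {perm X} * {perm X}) := (pw xy.1 xy.2 a, pw xy.1 xy.2 b).
pose Psi (xy : {perm X} * {perm X}) := (pw xy.1 xy.2 c, pw xy.1 xy.2 d).
have PhiK : cancel Phi Psi by case=> x y; rewrite /Phi /Psi /= gC gD.
have [Phi' _ Phi'K] := injF_bij (can_inj PhiK).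
case: (Phi' (s, t)) (Phi'K (s, t)) => x y [<- <-].
by rewrite eval_wordE -/(pf _ _) -subE; apply: relC; rewrite abE.
Qed.

Lemma push_push (L : eqType) (k : L) (w : seq L) :
  freely_reduced id w -> push id k (push id k w) = w.
Proof.
case: w => [|l w] /=; first by rewrite eqxx.
case: eqP => [<-|_ _]; last by rewrite /= eqxx.
by case: w => //= m w /andP[/negPf ->].
Qed.

(* The involutions act on reduced words of bounded length by prepending a
   letter, doing nothing when the result would be too long. *)
Lemma involutions_residually_finite (L : finType) (w : seq L) :
  freely_reduced id w -> w != [::] ->
  exists (X : finType) (x : L -> {perm X}),
    (forall k, involutive (x k)) /\ ev x w <> idfun.
Proof.
move=> rw w0; pose n := size w.
pose act (k : L) (u : n.-bseq L) : n.-bseq L :=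
  if freely_reduced id u then insubd u (push id k u) else u.
have actK k : involutive (act k).
  move=> u; rewrite /act.
  case: (boolP (freely_reduced id u)) => [ru|/negPf ru]; last by rewrite ru.
  case: (leqP (size (push id k u)) n) => su; last first.
    have -> : insubd u (push id k u) = u.
      by apply: val_inj; rewrite val_insubd leqNgt su.
    by rewrite ru; apply: val_inj; rewrite val_insubd leqNgt su.
  have vu : insubd u (push id k u) = push id k u :> seq L.
    by rewrite val_insubd su.
  rewrite vu push_reduced// push_push//; apply: val_inj; rewrite val_insubd.
  by rewrite size_bseq.
exists (n.-bseq L), (fun k => perm (inv_inj (actK k))); split.
  by move=> k u; rewrite !permE; exact: actK.
(* Acting on the empty word, every suffix of [w] rebuilds itself letter by letter and stays within
   the bound [size w]; so [w] moves the empty word. *)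
suff actE v : suffix v w ->
    val (ev (fun k => perm (inv_inj (actK k))) v ([bseq] : n.-bseq L)) = v.
  move=> /(congr1 (fun g => val (g ([bseq] : n.-bseq L)))).
  rewrite actE; last exact: suffix_refl.
  by rewrite /= => w1; move: w0; rewrite w1.
elim: v => [|k v IH] // kv.
have sv : suffix v w by apply: suffix_trans kv; apply/suffixP; exists [:: k].
have rkv : freely_reduced id (k :: v).
  by move/suffixP: kv rw => [u ->]; rewrite /freely_reduced => /cat_sorted2[].
set y := [bseq] : n.-bseq L in IH *.
have -> : forall x : L -> n.-bseq L -> n.-bseq L,
  ev x (k :: v) y = x k (ev x v y) by [].
rewrite permE /act IH// (freely_reduced_behead rkv) val_insubd IH//.
have -> : push id k v = k :: v.
  by case: v rkv {IH kv sv} => //= l v /andP[/negPf ->].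
by rewrite (size_suffix kv).
Qed.

(* None, Some true and Some false stand for E, EA and EB. *)
Definition half_turns (T : Type) (E EA EB : T -> T) (l : option bool) : T -> T :=
  if l is Some b then if b then EA else EB else E.

(** Two consecutive half-turns f, g are rewritten as (f E)(E g): E followed by a half-turn in the
    word is a generator, the opposite order is its inverse, and E E disappears. A last unpaired
    letter is dropped, so the length is meant to be even. *)
Fixpoint pair_word (w : seq (option bool)) : word :=
  if w is i :: j :: w' then
    (if i is Some b then [:: (b, true)] else [::]) ++
    (if j is Some b then [:: (b, false)] else [::]) ++ pair_word w'
  else [::].

Lemma ev_pair_word (T : Type) (E EA EB : T -> T) (w : seq (option bool)) :
  involutive E -> involutive EA -> involutive EB -> ~~ odd (size w) ->
  eval_word (E \o EA) (EA \o E) (E \o EB) (EB \o E) (pair_word w) =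
  ev (half_turns E EA EB) w.
Proof.
move=> EK EAK EBK; have [n] := ubnP (size w); elim: n w => // n IH [|i [|j w]] //=.
move=> wn; rewrite negbK => ew.
have {}IH : eval_word (E \o EA) (EA \o E) (E \o EB) (EB \o E) (pair_word w) =
    ev (half_turns E EA EB) w by apply: IH => //; lia.
rewrite !eval_wordE !ev_cat; rewrite eval_wordE in IH; rewrite IH.
apply/funext => z /=.
by case: i j => [[]|] [[]|]; rewrite /letter /= ?EK ?EAK ?EBK.
Qed.

Section FreeHalfTurns.
Variables (T : Type) (E EA EB : T -> T).
Hypotheses (EK : involutive E) (EAK : involutive EA) (EBK : involutive EB).
Hypotheses (E1 : E <> idfun) (EA1 : EA <> idfun) (EB1 : EB <> idfun).
Let f := half_turns E EA EB.
Let G := generated [set E \o EA; E \o EB].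

Lemma half_turnsK k : involutive (f k). Proof. by case: k => [[]|]. Qed.

Lemma generated_even_words :
  G = [set g | exists2 w, ~~ odd (size w) & g = ev f w].
Proof.
have AK : cancel (E \o EA) (EA \o E) by move=> z /=; rewrite EK EAK.
have A'K : cancel (EA \o E) (E \o EA) by move=> z /=; rewrite EAK EK.
have BK : cancel (E \o EB) (EB \o E) by move=> z /=; rewrite EK EBK.
have B'K : cancel (EB \o E) (E \o EB) by move=> z /=; rewrite EBK EK.
rewrite /G (generated_words AK A'K BK B'K); apply/seteqP; split; last first.
  by move=> _ [w ew ->]; exists (pair_word w) => //; rewrite ev_pair_word.
move=> _ [u _ <-]; elim: u => [|k u [w ew uE]]; first by exists [::].
have [i [j ij]] : exists i j, letter (E \o EA) (EA \o E) (E \o EB) (EB \o E) k =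
    f i \o f j.
  case: k => [[] []]; [exists (Some true), None|exists None, (Some true)|
    exists (Some false), None|exists None, (Some false)]; by [].
exists [:: i, j & w]; first by rewrite /= negbK.
by rewrite eval_wordE /= -eval_wordE uE -/(letter _ _ _ _) ij.
Qed.

Hypothesis freeG : free_rank_two G.

(* A relation of odd length would, up to conjugation, square to a reduced relation
   of even length, and the latter is a relation between A and B. *)
Lemma half_turns_free w : freely_reduced id w -> w != [::] -> ev f w <> idfun.
Proof.
have even u : ~~ odd (size u) -> freely_reduced id u -> u != [::] ->
    ev f u <> idfun.
  move=> eu ru u0 u1.
  have [X [x [xK]]] := involutions_residually_finite ru u0; apply.
  have [C [C' [D [D' [[CK C'K] [DK D'K] defG free]]]]] := freeG.
  have eqf : x = half_turns (x None) (x (Some true)) (x (Some false)) :> (_ -> X -> X).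
    by apply/funext => -[[]|].
  (* Products of permutations act from left to right, so [s] and [t] are the finite counterparts of
     [E \o EA] and [E \o EB]. *)
  pose s := (x (Some true) * x None)%g; pose t := (x (Some false) * x None)%g.
  have sE : s = x None \o x (Some true) :> (X -> X).
    by apply/funext => z; rewrite permM.
  have tE : t = x None \o x (Some false) :> (X -> X).
    by apply/funext => z; rewrite permM.
  have sV : (s^-1)%g = x (Some true) \o x None :> (X -> X).
    by apply/funext => z; apply: (@perm_inj _ s); rewrite permKV sE /= !xK.
  have tV : (t^-1)%g = x (Some false) \o x None :> (X -> X).
    by apply/funext => z; apply: (@perm_inj _ t); rewrite permKV tE /= !xK.
  rewrite eqf -ev_pair_word// -sE -sV -tE -tV.
  apply: (@hopf T C C' D D' (E \o EA) (EA \o E) (E \o EB) (EB \o E)) => //.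
  - by move=> z /=; rewrite EK EAK.
  - by move=> z /=; rewrite EAK EK.
  - by move=> z /=; rewrite EK EBK.
  - by move=> z /=; rewrite EBK EK.
  - by rewrite ev_pair_word.
have [n] := ubnP (size w); elim: n w => // n IH w wn rw w0 w1.
have [|ow] := boolP (~~ odd (size w)); first by move=> ew; exact: even w1.
case: w wn rw w0 w1 ow => // k w; case/lastP: w => [|w l] wn rw _ w1 ow.
  by case: k w1 {wn rw ow} => [[]|].
have [kl|kl] := eqVneq k l; last first.
  apply: (even (k :: rcons w l ++ k :: rcons w l)) => //.
  - by move: ow; rewrite /= size_cat /= size_rcons /=; lia.
  - move: rw; rewrite /freely_reduced /= cat_path /= last_rcons => ->.
    by rewrite /= kl.
  - by rewrite -cat_cons ev_cat w1.
have w'1 : ev f w = idfun.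
  apply/funext => z; apply: (can_inj (half_turnsK k)).
  have := congr1 (fun g => g (f l z)) w1; rewrite /= -cats1 ev_cat /= half_turnsK => ->.
  by rewrite kl.
apply: (IH w) => //.
- by move: wn; rewrite /= size_rcons; lia.
- move: rw; rewrite /freely_reduced /= rcons_path => /andP[/path_sorted + _] //.
- case: w ow {wn rw w1 w'1} => //=.
Qed.

End FreeHalfTurns.

Lemma odd_count_push (L : eqType) (k i : L) (w : seq L) :
  odd (count_mem k (push id i w)) = (i == k) (+) odd (count_mem k w).
Proof.
case: w => [|l w] /=; first by rewrite addn0 addbF oddb.
case: eqP => [<-|_] /=; last by rewrite oddD oddb.
by rewrite oddD oddb addbA addbb.
Qed.

Lemma odd_count_normal_form (L : eqType) (k : L) (w : seq L) :
  odd (count_mem k (normal_form id w)) = odd (count_mem k w).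
Proof. by elim: w => //= i w IH; rewrite odd_count_push IH oddD oddb. Qed.

(** The condition [k != l] makes the junctions between consecutive copies reduced. *)
Lemma freely_reduced_power (L : eqType) (k l : L) (w : seq L) (n : nat) :
  k != l -> freely_reduced id (k :: rcons w l) ->
  freely_reduced id (iter n (cat (k :: rcons w l)) [::]).
Proof.
move=> kl rw; elim: n => // n; rewrite iterS.
case: n => [|n]; first by rewrite cats0.
have [X ->] : exists X, iter n.+1 (cat (k :: rcons w l)) [::] = k :: X by eexists.
rewrite /freely_reduced /= cat_path last_rcons /= kl => ->.
by rewrite !andbT; exact: rw.
Qed.

(** * Fixed points of words in the half-turns, on an invariant set with finite stabilizers *)

Section FixedPointsOfHalfTurns.
Variables (T : Type) (E EA EB : T -> T).
Hypotheses (EK : involutive E) (EAK : involutive EA) (EBK : involutive EB).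
Hypotheses (E1 : E <> idfun) (EA1 : EA <> idfun) (EB1 : EB <> idfun).
Let f := half_turns E EA EB.
Let G := generated [set E \o EA; E \o EB].
Hypothesis freeG : free_rank_two G.
Variable D : set T.
Hypothesis fD : forall k z, D z -> D (f k z).
Hypothesis finite_stab : forall z, D z -> finite_set [set g | G g /\ g z = z].

Let fI k : involutive (f k). Proof. exact: half_turnsK. Qed.

Let fK k : cancel (f (id k)) (f k). Proof. exact: fI. Qed.

Let free := half_turns_free EK EAK EBK E1 EA1 EB1 freeG.

Lemma relation_parity w k : ev f w = idfun -> ~~ odd (count_mem k w).
Proof.
rewrite -(ev_normal_form fK) -odd_count_normal_form => w1.
have := @normal_form_reduced _ id w; case: (normal_form id w) w1 => // i u u1 ru.
by case: (free ru).
Qed.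

Lemma cyclically_reduced_fixes k l w z : k != l ->
  freely_reduced id (k :: rcons w l) -> D z -> ev f (k :: rcons w l) z <> z.
Proof.
move=> kl rw Dz wz; pose W n := iter n (cat (k :: rcons w l)) [::].
have WD m n : W (m + n)%N = W m ++ W n.
  by elim: m => //= m IH; rewrite -catA -IH.
have evWz n : ev f (W n) z = z.
  by elim: n => // n IH; rewrite /W iterS ev_cat -/(W n) /= IH -[RHS]wz.
(* Only even powers are used: the word may have odd length, and then its odd powers are not given by
   even words. *)
have eW n : ~~ odd (size (W n.*2)) by rewrite -addnn WD size_cat oddD addbb.
have injW : injective (fun n => ev f (W n.*2)).
  suff lt_inj m n : (m < n)%N -> ev f (W m.*2) <> ev f (W n.*2).
    by move=> m n mn; case: (ltngtP m n) => // /lt_inj; [|move/nesym].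
  (* The difference of the exponents is written as a successor, so that the remaining power is
     visibly nonempty. *)
  move=> mn; rewrite -(subnKC mn) addSnnS doubleD WD ev_cat => e.
  apply: (@free (W (n - m.+1).+1.*2)) => //.
    exact: freely_reduced_power.
  apply/funext => y; apply: (ev_inj (fun=> erefl) fK (w := W m.*2)).
  by have := congr1 (fun g => g y) e.
have /(finite_preimage (f := fun n => ev f (W n.*2))) := finite_stab Dz.
move=> fin; apply: infinite_nat; move: (fin (in2W injW)); apply: sub_finite_set.
move=> n _ /=; split; last exact: evWz.
by rewrite /G (generated_even_words EK EAK EBK); exists (W n.*2).
Qed.

(** Peeling off equal first and last letters [k] conjugates the word, moves [z] to [f k z] and
    shortens the word by two. A cyclically reduced word of length at least two fixes nothing, so the
    process ends at a single letter, which also gives the parity. *)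
Lemma fixing_word w z : freely_reduced id w -> w != [::] -> D z ->
  ev f w z = z -> odd (size w) /\
  exists u k y, [/\ z = ev f u y, f k y = y & D y].
Proof.
have [n] := ubnP (size w); elim: n w z => // n IH w z wn rw w0 Dz wz.
case: w wn rw w0 wz => // k w; case/lastP: w => [|w l] wn rw _ wz.
  by split => //; exists [::], k, z.
have [kl|kl] := eqVneq k l; last by case: (cyclically_reduced_fixes kl rw Dz).
subst l.
have w'z : ev f w (f k z) = f k z.
  by apply: (can_inj (fI k)); rewrite fI -{2}wz -cats1 -cat1s !ev_cat.
have [] := IH w (f k z) => //.
- by move: wn; rewrite /= size_rcons; lia.
- by move: rw; rewrite /freely_reduced /= rcons_path => /andP[/path_sorted].
- by case: w rw {wn wz w'z} => //=; rewrite /freely_reduced /= eqxx.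
- exact: fD.
move=> ow [u [m [y [zy my Dy]]]]; split; first by rewrite /= size_rcons /= negbK.
by exists (k :: u), m, y; split => //=; rewrite -zy fI.
Qed.

(** Reduction preserves the parity of the length, and a nonempty reduced word with a fixed point in
    [D] has odd length. Hence [G] acts freely on [D]. *)
Lemma even_word_fixes w z : ~~ odd (size w) -> D z -> ev f w z = z ->
  ev f w = idfun.
Proof.
have [u uE] : exists u, u = normal_form id w by exists (normal_form id w).
have ru : freely_reduced id u by rewrite uE; exact: normal_form_reduced.
have szE : odd (size u) = odd (size w).
  rewrite uE; elim: (w) => //= i v <-; case: (normal_form id v) => //= l v'.
  by case: eqP => //=; rewrite negbK.
rewrite -(ev_normal_form fK) -uE -szE; case: (eqVneq u [::]) => [->//|u0].
by move=> eu Dz /(fixing_word ru u0 Dz)[]; rewrite (negPf eu).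
Qed.

Lemma odd_word_fixes w z : odd (size w) -> D z -> ev f w z = z ->
  exists g k y, [/\ G g, z = g y & f k y = y].
Proof.
move=> ow Dz wz.
have [u uE] : exists u, u = normal_form id w by exists (normal_form id w).
have ru : freely_reduced id u by rewrite uE; exact: normal_form_reduced.
(* Were [w] a relation, each of the three letters would occur an even number of times and the length
   would be even. *)
have u0 : u != [::].
  apply: contraTneq ow => u0; have : ev f w = idfun.
    by rewrite -(ev_normal_form fK) -uE u0.
  move=> w1; have cnt k := relation_parity k w1.
  have -> : size w = (count_mem None w + count_mem (Some true) w +
                     count_mem (Some false) w)%N.
    by elim: (w) => //= -[[]|] v -> /=; lia.
  by rewrite !oddD !(negPf (cnt _)).
rewrite -(ev_normal_form fK) -uE in wz.
have [_ [v [k [y [zv ky Dy]]]]] := fixing_word ru u0 Dz wz.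
(* An odd conjugating word is made even by appending [k], which fixes [y]. *)
case: (boolP (odd (size v))) => ov.
  exists (ev f (rcons v k)), k, y; split => //.
    rewrite /G (generated_even_words EK EAK EBK); exists (rcons v k) => //.
    by rewrite size_rcons /= negbK.
  by rewrite -cats1 ev_cat /= ky.
exists (ev f v), k, y; split => //.
by rewrite /G (generated_even_words EK EAK EBK); exists v.
Qed.

End FixedPointsOfHalfTurns.

(** * Moebius transformations *)

Section Mobius.
Variable R : realType.
Local Notation C := (Cplx R).
Implicit Types (M N : 'M[C]_2) (f g : sphere R -> sphere R).

Lemma ord2P (P : 'I_2 -> Prop) : P ord0 -> P ord_max -> forall i, P i.
Proof.
move=> P0 P1 [[|[|//]] i2]; first by rewrite (_ : Ordinal i2 = ord0)//; exact: val_inj.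
by rewrite (_ : Ordinal i2 = ord_max)//; exact: val_inj.
Qed.

Lemma lift_ord2 : lift (ord0 : 'I_2) ord0 = ord_max.
Proof. exact: val_inj. Qed.

Lemma lift_ord2' : lift (ord_max : 'I_2) ord0 = ord0.
Proof. exact: val_inj. Qed.

Lemma det2 (K : comNzRingType) (M : 'M[K]_2) :
  \det M = M ord0 ord0 * M ord_max ord_max - M ord0 ord_max * M ord_max ord0.
Proof.
rewrite (expand_det_row _ ord0) !big_ord_recl big_ord0 /cofactor.
rewrite !det_mx11 !mxE /= addr0 lift_ord2 lift_ord2' /=.
by rewrite expr0 expr1; ring.
Qed.

Lemma tr2 (K : pzRingType) (M : 'M[K]_2) :
  \tr M = M ord0 ord0 + M ord_max ord_max.
Proof. by rewrite /mxtrace !big_ord_recl big_ord0 addr0 lift_ord2. Qed.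

Lemma mul2E (K : pzRingType) (M N : 'M[K]_2) i j :
  (M *m N) i j = M i ord0 * N ord0 j + M i ord_max * N ord_max j.
Proof. by rewrite mxE !big_ord_recl big_ord0 addr0 lift_ord2. Qed.

Definition mx2 (K : Type) (a b c d : K) : 'M[K]_2 :=
  \matrix_(i, j) if i == ord0 then if j == ord0 then a else b
                 else if j == ord0 then c else d.

Lemma mx2E (K : Type) (a b c d : K) :
  ((mx2 a b c d ord0 ord0 = a) * (mx2 a b c d ord0 ord_max = b) *
   (mx2 a b c d ord_max ord0 = c) * (mx2 a b c d ord_max ord_max = d))%type.
Proof. by rewrite !mxE. Qed.

Lemma mobius_comp M N : \det N != 0 -> mobius (M *m N) = mobius M \o mobius N.
Proof.
rewrite det2 => dN; apply/funext => z; rewrite /mobius /= !mul2E.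
move: (M ord0 ord0) (M ord0 ord_max) (M ord_max ord0) (M ord_max ord_max).
move: (N ord0 ord0) (N ord0 ord_max) (N ord_max ord0) (N ord_max ord_max) dN.
move=> a b c d dN a' b' c' d'; case: z => [x|].
  have [cd|cd] := eqVneq (c * x + d) 0.
    (* Numerator and denominator of the inner map cannot vanish together, because [N] is
       invertible. *)
    have ab : a * x + b != 0.
      apply: contraNneq dN => ab; apply/eqP.
      have [x0|x0] := eqVneq x 0.
        by move: ab cd; rewrite x0 !mulr0 !add0r => -> ->; ring.
      apply: (mulIf x0); rewrite mul0r.
      have -> : (a * d - b * c) * x = (a * x + b) * d - b * (c * x + d) by ring.
      by rewrite ab cd; ring.
    have -> : (c' * a + d' * c) * x + (c' * b + d' * d) = c' * (a * x + b).
      by rewrite -[RHS]addr0 -(mulr0 d') -cd; ring.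
    have -> : (a' * a + b' * c) * x + (a' * b + b' * d) = a' * (a * x + b).
      by rewrite -[RHS]addr0 -(mulr0 b') -cd; ring.
    rewrite mulf_eq0 (negPf ab) orbF; case: ifP => // _.
    by rewrite -mulf_div divff// mulr1.
  have -> : (c' * a + d' * c) * x + (c' * b + d' * d) =
      (c' * ((a * x + b) / (c * x + d)) + d') * (c * x + d) by field.
  have -> : (a' * a + b' * c) * x + (a' * b + b' * d) =
      (a' * ((a * x + b) / (c * x + d)) + b') * (c * x + d) by field.
  rewrite mulf_eq0 (negPf cd) orbF; case: ifP => // _.
  by rewrite -mulf_div divff// mulr1.
have [c0|c0] := eqVneq c 0.
  move: dN; rewrite c0 mulr0 subr0 mulf_eq0 negb_or => /andP[a0 _].
  rewrite !mulr0 !addr0 mulf_eq0 (negPf a0) orbF; case: ifP => // _.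
  by rewrite -mulf_div divff// mulr1.
have -> : c' * a + d' * c = (c' * (a / c) + d') * c by field.
have -> : a' * a + b' * c = (a' * (a / c) + b') * c by field.
rewrite mulf_eq0 (negPf c0) orbF; case: ifP => // _.
by rewrite -mulf_div divff// mulr1.
Qed.

Lemma mobius_scalar (k : C) : k != 0 -> mobius k%:M = idfun.
Proof.
move=> k0; apply/funext => -[x|]; rewrite /mobius !mxE /= ?mulr1n ?mulr0n ?eqxx//.
by rewrite mul0r add0r addr0 (negPf k0) mulrAC divff// mul1r.
Qed.

Lemma mobius_scale (k : C) M : k != 0 -> mobius (k *: M) = mobius M.
Proof.
move=> k0; apply/funext => -[x|]; rewrite /mobius !mxE.
  rewrite -!mulrA -!mulrDr mulf_eq0 (negPf k0) /=; case: ifP => // _.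
  by rewrite -mulf_div divff// mul1r.
by rewrite mulf_eq0 (negPf k0) /=; case: ifP => // _; rewrite -mulf_div divff// mul1r.
Qed.

Lemma mobiusK M : \det M != 0 -> cancel (mobius M) (mobius (invmx M)).
Proof.
move=> dM z; have uM : M \in unitmx by rewrite unitmxE unitfE.
have := mobius_comp (invmx M) dM; rewrite mulVmx// mobius_scalar ?oner_neq0//.
by move=> /(congr1 (fun g => g z)).
Qed.

(** The values at infinity, 0 and 1 give in turn c = 0, b = 0 and a = d. *)
Lemma mobius_id_scalar M : \det M != 0 -> mobius M = idfun ->
  M = (M ord0 ord0)%:M.
Proof.
rewrite det2 => dM M1.
have := congr1 (fun g => g None) M1; have := congr1 (fun g => g (Some 0)) M1.
have := congr1 (fun g => g (Some 1)) M1; rewrite /mobius /=.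
move: dM; case: ifP => // /negbT n1 dM [e1]; case: ifP => // /negbT n0 [e0].
case: eqP => // c0 _.
move: e0 n0; rewrite !mulr0 !add0r => /eqP; rewrite mulf_eq0 invr_eq0.
move=> /orP[/eqP b0 _|/eqP->]; last by rewrite eqxx.
move: e1 n1; rewrite b0 c0 !mulr1 addr0 add0r => e1 d0.
have {e1} ad : M ord0 ord0 = M ord_max ord_max.
  by rewrite -[RHS]mul1r -[in RHS]e1 mulfVK.
by apply/matrixP; apply: ord2P; apply: ord2P; rewrite mxE //= ?mulr1n ?mulr0n.
Qed.

(** Cayley-Hamilton in trace zero. *)
Lemma mul2_tr0 M : \tr M = 0 -> M *m M = (- \det M)%:M.
Proof.
rewrite tr2 det2 addrC => /eqP; rewrite addr_eq0 => /eqP dE.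
apply/matrixP; apply: ord2P; apply: ord2P; rewrite mul2E mxE dE /= ?mulr1n ?mulr0n; ring.
Qed.

Lemma mobius_tr0_involutive M : \det M != 0 -> \tr M = 0 -> involutive (mobius M).
Proof.
move=> dM /mul2_tr0 MM z; have := congr1 (fun g => g z) (mobius_comp M dM).
by rewrite MM mobius_scalar ?oppr_eq0//= => <-.
Qed.

(** The off-diagonal entries of M^2 are b tr M and c tr M, and its diagonal entries differ by (d -
    a) tr M. Since M^2 is scalar, a nonzero trace would make M scalar too. *)
Lemma mobius_involutive_tr0 M : \det M != 0 -> mobius M <> idfun ->
  involutive (mobius M) -> \tr M = 0.
Proof.
move=> dM M1 MK; have MM : mobius (M *m M) = idfun.
  by rewrite mobius_comp//; apply/funext => z /=; rewrite MK.
have /mobius_id_scalar : \det (M *m M) != 0 by rewrite det_mulmx mulf_neq0.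
move=> /(_ MM) MMs; rewrite tr2; apply/eqP; apply/negP => /negP t0; apply: M1.
have e01 := congr1 (fun N : 'M[C]_2 => N ord0 ord_max) MMs.
have e10 := congr1 (fun N : 'M[C]_2 => N ord_max ord0) MMs.
have e11 := congr1 (fun N : 'M[C]_2 => N ord_max ord_max) MMs.
move: e01 e10 e11; rewrite !mul2E !mxE /= ?mulr0n ?mulr1n => e01 e10 e11.
have {}e01 : M ord0 ord_max = 0 by apply: (mulIf t0); rewrite mul0r -[RHS]e01; ring.
have {}e10 : M ord_max ord0 = 0 by apply: (mulIf t0); rewrite mul0r -[RHS]e10; ring.
have {}e11 : M ord_max ord_max = M ord0 ord0.
  apply/eqP; rewrite -subr_eq0; apply/eqP; apply: (mulIf t0); rewrite mul0r.
  move: e11; rewrite e01 e10 !mul0r add0r addr0 => e11.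
  have -> : (M ord_max ord_max - M ord0 ord0) * (M ord0 ord0 + M ord_max ord_max) =
    M ord_max ord_max * M ord_max ord_max - M ord0 ord0 * M ord0 ord0 by ring.
  by rewrite e11 subrr.
have -> : M = (M ord0 ord0)%:M.
  by apply/matrixP; apply: ord2P; apply: ord2P; rewrite mxE /= ?mulr1n ?mulr0n.
apply: mobius_scalar; apply: contraNneq t0 => a0; by rewrite e11 a0 addr0.
Qed.

Lemma mobius_swap_tr0 M (u v : C) : u != v ->
  mobius M (Some u) = Some v -> mobius M (Some v) = Some u -> \tr M = 0.
Proof.
rewrite /mobius tr2 => uv; case: ifP => // /negbT nu [ue]; case: ifP => // /negbT nv [ve].
have uv0 : u - v != 0 by rewrite subr_eq0.
apply: (mulIf uv0); rewrite mul0r.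
have {}ue : M ord0 ord0 * u + M ord0 ord_max = v * (M ord_max ord0 * u + M ord_max ord_max).
  by rewrite -ue mulfVK.
have {}ve : M ord0 ord0 * v + M ord0 ord_max = u * (M ord_max ord0 * v + M ord_max ord_max).
  by rewrite -ve mulfVK.
have -> : (M ord0 ord0 + M ord_max ord_max) * (u - v) =
 (M ord0 ord0 * u + M ord0 ord_max - (M ord0 ord0 * v + M ord0 ord_max)) +
  M ord_max ord_max * (u - v) by ring.
rewrite ue ve; ring.
Qed.

Lemma is_mobius_det1 f : is_mobius f ->
  exists M, \det M = 1 /\ f = mobius M.
Proof.
move=> [M [uM ->]]; have dM : \det M != 0 by move: uM; rewrite unitmxE unitfE.
have sM : sqrtC (\det M) != 0 by rewrite sqrtC_eq0.
exists ((sqrtC (\det M))^-1 *: M); split; last first.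
  by rewrite mobius_scale// invr_eq0.
by rewrite detZ exprVn sqrtCK mulVf.
Qed.

End Mobius.

(** The polynomial changes sign at 1, so its value [v] there is 0; the continuity argument is made
    quantitative, with an explicit step [s]. *)
Lemma quadratic_sign_change (F : realFieldType) (a b c : F) :
  (forall r, 0 < r < 1 -> a * r ^+ 2 + b * r + c < 0) ->
  (forall r, 1 < r -> 0 <= a * r ^+ 2 + b * r + c) -> a + b + c = 0.
Proof.
move=> neg pos; pose v := a + b + c; rewrite -/v.
apply/eqP; apply/negP => /negP v0; have nv : 0 < `|v| by rewrite normr_gt0.
pose K := `|2 * a + b| + `|a|.
have K0 : 0 <= K by rewrite addr_ge0.
(* Between 1 and 1 - s or 1 + s the polynomial varies by at most s K, and this choice makes s K
   smaller than |v| / 2. *)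
pose s := `|v| / (2 * (`|v| + K)).
have d0 : 0 < 2 * (`|v| + K) by rewrite mulr_gt0// ltr_pwDl.
have s0 : 0 < s by rewrite divr_gt0.
have s1 : s < 1 by rewrite ltr_pdivrMr// mul1r; lra.
have sE : s * (2 * (`|v| + K)) = `|v| by rewrite mulfVK// gt_eqF.
have n1 := neg (1 - s); have p1 := pos (1 + s).
have {}n1 : v < s * (2 * a + b) - s ^+ 2 * a.
  have : a * (1 - s) ^+ 2 + b * (1 - s) + c < 0 by apply: n1; lra.
  by rewrite /v => ?; nra.
have {}p1 : - v <= s * (2 * a + b) + s ^+ 2 * a.
  have : 0 <= a * (1 + s) ^+ 2 + b * (1 + s) + c by apply: p1; lra.
  by rewrite /v => ?; nra.
have t1 : s * (2 * a + b) <= s * `|2 * a + b| by rewrite ler_wpM2l ?ler_norm// ltW.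
have ss : s ^+ 2 <= s by nra.
have t2 : s ^+ 2 * `|a| <= s * `|a| by rewrite ler_wpM2r.
have t3 : s ^+ 2 * a <= s ^+ 2 * `|a| by rewrite ler_wpM2l ?ler_norm// sqr_ge0.
have t4 : - (s ^+ 2 * a) <= s ^+ 2 * `|a|.
  by rewrite -mulrN ler_wpM2l ?sqr_ge0// -normrN ler_norm.
have sK : s * K = s * `|2 * a + b| + s * `|a| by rewrite /K; ring.
have : `|v| <= s * K by rewrite ler_norml; apply/andP; split; lra.
have : 0 < s * `|v| by rewrite mulr_gt0.
have : s * (2 * (`|v| + K)) = 2 * (s * `|v|) + 2 * (s * K) by ring.
rewrite sE; lra.
Qed.

(** * Matrices preserving the disc *)

Section DiscGroup.
Variable R : realType.
Local Notation C := (Cplx R).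
Implicit Types (M N : 'M[C]_2).

Lemma conjE :
  ((forall x y : C, (x + y)^* = (x^* + y^*)%R) *
   (forall x y : C, (x * y)^* = (x^* * y^*)%R) *
   (forall x : C, (- x)^* = (- x^*)%R) *
   (forall x : C, x^*^* = x) * ((0 : C)^* = 0%R) * ((1 : C)^* = 1%R))%type.
Proof.
do ![split]; do ?move=> ?.
- exact: rmorphD.
- exact: rmorphM.
- exact: rmorphN.
- exact: conjCK.
- exact: rmorph0.
- exact: rmorph1.
Qed.

Definition su11 M := [/\ M ord_max ord_max = (M ord0 ord0)^*,
  M ord_max ord0 = (M ord0 ord_max)^* &
  M ord0 ord0 * (M ord0 ord0)^* - M ord0 ord_max * (M ord0 ord_max)^* = 1].

Lemma disc_Some (z : C) : disc R (Some z) <-> `|z| < 1.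
Proof. by split=> [[y y1 [<-]]//|z1]; exists z. Qed.

Lemma disc_None : ~ disc R None.
Proof. by case. Qed.

Lemma ltr_normCK (x y : C) : (`|x| < `|y|) = (x * x^* < y * y^*).
Proof. by rewrite -!normCK ltr_pXn2r// nnegrE. Qed.

Lemma disc_su11 M : \det M = 1 -> mobius M @` disc R = disc R -> su11 M.
Proof.
move=> dM MD; have dM0 : \det M != 0 by rewrite dM oner_neq0.
have Dout z : ~ disc R z -> ~ disc R (mobius M z).
  by move=> nz; rewrite -MD => -[y Dy] /(can_inj (mobiusK dM0)) yz; apply: nz; rewrite -yz.
have Din z : disc R z -> disc R (mobius M z) by move=> Dz; rewrite -MD; exists z.
rewrite det2 in dM; move: dM Dout Din {MD dM0}; rewrite /su11 /mobius.
set a := M ord0 ord0; set b := M ord0 ord_max.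
set c := M ord_max ord0; set d := M ord_max ord_max => dM Dout Din.
(* The Hermitian form Q is negative inside and nonnegative outside the unit
   circle, so it vanishes on the circle. *)
pose Q z := (a * z + b) * (a * z + b)^* - (c * z + d) * (c * z + d)^*.
have Qin (z : C) : `|z| < 1 -> Q z < 0.
  move=> /disc_Some/Din; case: ifP => [_ /disc_None//|/negbT cd].
  move=> /disc_Some; rewrite normf_div ltr_pdivrMr ?normr_gt0// mul1r.
  by rewrite ltr_normCK subr_lt0.
have Qout (z : C) : 1 < `|z| -> 0 <= Q z.
  move=> z1; have /Dout : ~ disc R (Some z).
    by move=> /disc_Some z1'; have := lt_trans z1 z1'; rewrite ltxx.
  case: ifP => [/eqP cd _|/negbT cd].
    by rewrite /Q cd mul0r subr0 -normCK exprn_ge0.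
  move=> nD; rewrite subr_ge0 -!normCK ler_pXn2r ?nnegrE// real_leNgt ?normr_real//.
  apply/negP => lt; apply: nD; apply/disc_Some.
  by rewrite normf_div ltr_pdivrMr ?normr_gt0// mul1r.
pose P := a * a^* - c * c^*; pose S := b * b^* - d * d^*.
pose h := a * b^* - c * d^*.
have toR (x : C) : x^* = x -> x = ((complex.Re x)%:C)%C.
  by move=> xr; rewrite [RHS]RRe_real//; apply/CrealP.
have rlt (x y : R) : ((x%:C)%C < (y%:C)%C :> C) = (x < y) := ltcR x y.
have rle (x y : R) : ((x%:C)%C <= (y%:C)%C :> C) = (x <= y) := lecR x y.
(* Along the ray through a point [w] of the circle, Q (r w) is a real quadratic polynomial in r to
   which [quadratic_sign_change] applies. *)
have QE (w : C) : w * w^* = 1 -> P + (h * w + (h * w)^*) + S = 0.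
  move=> ww; pose k := h * w + (h * w)^*.
  have kr : k^* = k by rewrite /k !conjE addrC.
  have Pr : P^* = P by rewrite /P !conjE; ring.
  have Sr : S^* = S by rewrite /S !conjE; ring.
  have nw : `|w| = 1.
    by apply/eqP; rewrite -[_ == _](@eqrXn2 _ 2)// normCK ww expr1n.
  have QrE (r : R) : Q ((r%:C)%C * w) =
     ((complex.Re P * r ^+ 2 + complex.Re k * r + complex.Re S)%:C)%C.
    rewrite expr2 !rmorphD !rmorphM /= -!toR//.
    have rr : ((r%:C)%C : C)^* = (r%:C)%C.
      by apply/CrealP; apply/complex_realP; exists r.
    rewrite /Q /P /k /h /S !conjE rr.
    rewrite -[a * a^* - c * c^*]mulr1 -ww; ring.
  have : (complex.Re P + complex.Re k + complex.Re S)%:C%C = 0 :> C.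
    rewrite (@quadratic_sign_change R (complex.Re P) (complex.Re k) (complex.Re S))//.
      move=> r /andP[r0 r1]; have := Qin ((r%:C)%C * w).
      rewrite normrM nw mulr1 QrE ger0_norm; last by rewrite (rle 0) ltW.
      by rewrite (rlt _ 1) (rlt _ 0); exact.
    move=> r r1; have := Qout ((r%:C)%C * w).
    rewrite normrM nw mulr1 QrE ger0_norm; last by rewrite (rle 0); lra.
    by rewrite (rlt 1) (rle 0); exact.
  by rewrite !rmorphD /= -!toR.
(* The three points 1, -1 and i suffice to separate [P + S] from the real and imaginary parts of
   [h]. *)
have /QE : (1 : C) * 1^* = 1 by rewrite conjE mulr1.
rewrite mulr1 => q1.
have /QE : (-1 : C) * (-1)^* = 1 by rewrite !conjE mulrNN mulr1.
rewrite mulrN1 conjE -opprD => qN.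
have /QE : ('i : C) * 'i^* = 1 by rewrite conjCi mulrN -expr2 sqrCi opprK.
rewrite conjE conjCi mulrN [h * _]mulrC [h^* * _]mulrC -mulrBr => qi.
have PS : P + S = 0.
  have : (P + S) * 2 = 0 by rewrite -[RHS]addr0 -{1}q1 -qN; ring.
  by move/eqP; rewrite mulf_eq0 pnatr_eq0 orbF => /eqP.
have hp : h + h^* = 0 by rewrite -[RHS]q1 -[LHS]addr0 -PS; ring.
have hm : h - h^* = 0.
  apply: (mulfI (neq0Ci C)); rewrite mulr0 -[RHS]qi -[LHS]addr0 -PS; ring.
have h0 : h = 0.
  have : h * 2 = 0 by rewrite -[RHS]addr0 -{1}hp -hm; ring.
  by move/eqP; rewrite mulf_eq0 pnatr_eq0 orbF => /eqP.
have h0' : a^* * b - c^* * d = 0.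
  by have := congr1 (fun x : C => x^*) h0; rewrite /h !conjE.
(* Now [M] preserves the form |x|^2 - |y|^2 up to the factor [P]. Determinant 1 will give P^3 = P,
   and the sign of [Q 0] will leave only P = 1. *)
have aE : a^* = P * d.
  rewrite -[LHS]mulr1 -dM -[LHS]addr0 -(mulr0 c) -h0' /P; ring.
have cE : c^* = P * b.
  rewrite -[LHS]mulr1 -dM -[LHS]addr0 -(mulr0 a) -h0' /P; ring.
have Pr : P^* = P by rewrite /P !conjE; ring.
have a'E : a = P * d^* by rewrite -[LHS]conjCK aE conjE Pr.
have c'E : c = P * b^* by rewrite -[LHS]conjCK cE conjE Pr.
have P3 : P = P ^+ 3.
  have : P = (P * d^*) * (P * d) - (P * b^*) * (P * b).
    by rewrite -a'E -c'E -aE -cE.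
  move=> {1}->; rewrite -[LHS]addr0 -(mulr0 (P ^+ 2)) -PS /S; ring.
have P0 : 0 < P.
  have := Qin 0; rewrite normr0 ltr01 => /(_ isT).
  rewrite /Q !mulr0 !add0r -/S => S0.
  by rewrite (_ : P = - S) ?oppr_gt0//; apply/eqP; rewrite -addr_eq0 PS.
have P1 : P = 1.
  apply/eqP; rewrite -subr_eq0.
  have : P * (P + 1) * (P - 1) = 0 by rewrite -[RHS](subrr P) {4}P3; ring.
  move=> /eqP; rewrite !mulf_eq0 (gt_eqF P0) gt_eqF//.
  by rewrite ltr_wpDr.
split.
- by rewrite aE P1 mul1r.
- by rewrite c'E P1 mul1r.
by rewrite -[RHS]P1 /P c'E P1 mul1r conjCK; ring.
Qed.

End DiscGroup.

(** * Half-turns of the disc and their fixed points *)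

Section HalfTurns.
Variable R : realType.
Local Notation C := (Cplx R).
Implicit Types (M N : 'M[C]_2).

(** With determinant 1 the cross-multiplied equation cannot degenerate to 0 = 0, so it also excludes
    the value infinity. *)
Lemma mobius_SomeE M (x y : C) : \det M = 1 -> mobius M (Some x) = Some y <->
  M ord0 ord0 * x + M ord0 ord_max = y * (M ord_max ord0 * x + M ord_max ord_max).
Proof.
rewrite det2 /mobius => dM; case: eqP => [D0|/eqP D0]; split => //.
- rewrite D0 mulr0 => N0.
  have : (M ord0 ord0 * M ord_max ord_max - M ord0 ord_max * M ord_max ord0) *
    (M ord0 ord0 * M ord_max ord_max - M ord0 ord_max * M ord_max ord0) = 0.
    have -> : M ord0 ord_max = - (M ord0 ord0 * x).
      by apply/eqP; rewrite -addr_eq0 addrC N0.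
    have -> : M ord_max ord_max = - (M ord_max ord0 * x).
      by apply/eqP; rewrite -addr_eq0 addrC D0.
    by ring.
  by rewrite dM mulr1 => /eqP; rewrite oner_eq0.
- by move=> [<-]; rewrite mulfVK.
- by move=> ->; rewrite mulfK.
Qed.

Lemma mobius_None_fix M : mobius M None = None <-> M ord_max ord0 = 0.
Proof. by rewrite /mobius; case: eqP. Qed.

Definition reflection (z : sphere R) : sphere R :=
  match z with
  | Some x => if x == 0 then None else Some (x^*)^-1
  | None => Some 0
  end.

Lemma su11_tr0_fix_equation M (x : C) : \det M = 1 -> su11 M -> \tr M = 0 ->
  mobius M (Some x) = Some x <->
  M ord_max ord0 * x ^+ 2 - 2 * M ord0 ord0 * x - M ord0 ord_max = 0.
Proof.
move=> dM [_ _ _]; rewrite tr2 => t0; rewrite mobius_SomeE//.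
have -> : M ord_max ord_max = - M ord0 ord0 by apply/eqP; rewrite -addr_eq0 addrC t0.
split=> [e|/eqP]; first by apply/eqP; rewrite -(subrr (M ord0 ord0 * x + M ord0 ord_max)) {1}e; apply/eqP; ring.
by move=> /eqP e; apply/eqP; rewrite -subr_eq0 -oppr_eq0; apply/eqP; rewrite -[RHS]e; ring.
Qed.

(** Here a is purely imaginary and c = conj b, so conjugating the fixed-point equation and dividing
    by -(conj x)^2 gives the same equation at 1 / conj x. *)
Lemma su11_tr0_reflection M z : \det M = 1 -> su11 M -> \tr M = 0 ->
  mobius M z = z -> mobius M (reflection z) = reflection z.
Proof.
move=> dM sM t0; have [dE cE _] := sM.
have aE : (M ord0 ord0)^* = - M ord0 ord0.
  by rewrite -dE; apply/eqP; rewrite -addr_eq0 addrC -tr2 t0.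
case: z => [x|] /=; last first.
  move=> /mobius_None_fix c0; apply/su11_tr0_fix_equation => //.
  have -> : M ord0 ord_max = 0 by rewrite -[LHS]conjCK -cE c0 conjC0.
  by rewrite mulr0 expr2 !mulr0 !subr0.
move=> /su11_tr0_fix_equation e; have {}e := e dM sM t0.
case: eqP => [x0|/eqP x0].
  apply/mobius_None_fix; rewrite cE; move: e; rewrite x0 expr2 !mulr0 subrr sub0r.
  by move/eqP; rewrite oppr_eq0 => /eqP ->; rewrite conjC0.
apply/su11_tr0_fix_equation => //.
have e' := congr1 (fun x : C => x^*) e.
move: e'; rewrite expr2 cE !conjE aE => e'.
have x0' : x^* != 0 by rewrite conjC_eq0.
have -> : forall b : C, b * (x^*)^-1 ^+ 2 - 2 * M ord0 ord0 * (x^*)^-1 - M ord0 ord_max =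
  - (M ord0 ord_max * (x^* * x^*) - 2 * (- M ord0 ord0) * x^* - b) / (x^* * x^*).
  by move=> b; field.
by rewrite e' oppr0 mul0r.
Qed.

(** On the circle the fixed-point equation reads 2a = c x - b conj x, whence |a| <= |b|, against
    |a|^2 - |b|^2 = 1. *)
Lemma su11_tr0_circle M (x : C) : \det M = 1 -> su11 M -> \tr M = 0 ->
  `|x| = 1 -> mobius M (Some x) <> Some x.
Proof.
move=> dM sM t0 x1 /su11_tr0_fix_equation e; have {}e := e dM sM t0.
have [dE cE n1] := sM.
have xx : x * x^* = 1 by rewrite -normCK x1 expr1n.
have e2 : 2 * M ord0 ord0 = M ord_max ord0 * x - M ord0 ord_max * x^*.
  apply/eqP; rewrite -subr_eq0; apply/eqP.
  rewrite -[RHS](mulr0 (- x^*)) -e -[2 * M _ _ in LHS]mulr1 -[M _ _ * x in LHS]mulr1 -xx.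
  ring.
have : `|2 * M ord0 ord0| <= `|2 * M ord0 ord_max|.
  rewrite e2 (le_trans (ler_normB _ _))// !normrM norm_conjC x1 cE norm_conjC !mulr1.
  by rewrite normr_nat mulr_natl mulr2n.
rewrite !normrM normr_nat ler_pM2l ?ltr0n// => le.
have : M ord0 ord0 * (M ord0 ord0)^* <= M ord0 ord_max * (M ord0 ord_max)^*.
  by rewrite -!normCK ler_pXn2r ?nnegrE.
by rewrite -subr_le0 n1 ler10.
Qed.

(** The reflection of [p] is fixed and differs from [p], which is not on the circle; so it is [q].
    The exterior of the closed disc, with infinity, is expressed through [sphere_inv]. *)
Lemma su11_tr0_fixpoints M p q : \det M = 1 -> su11 M -> \tr M = 0 ->
  fixpoints (mobius M) = [set p; q] ->
  disc R p /\ disc R (sphere_inv q) \/ disc R (sphere_inv p) /\ disc R q.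
Proof.
move=> dM sM t0 fE.
have fp : mobius M p = p by have : fixpoints (mobius M) p by rewrite fE; left.
have : fixpoints (mobius M) (reflection p) by exact: su11_tr0_reflection.
rewrite fE.
have caseE (x : C) : p = Some x -> `|x| < 1 \/ 1 < `|x|.
  move=> px; case: (real_ltgtP (normr_real x) (@real1 C)) => x1; [by left|by right|].
  by case: (su11_tr0_circle dM sM t0 x1); rewrite -px.
have big (x : C) : 1 < `|x| -> x != 0.
  by move=> x1; rewrite -normr_gt0 (lt_trans _ x1)// ltr01.
case: p fp caseE {fE} => [x|] fp caseE; last first.
  case=> //= <-; right; split; apply/disc_Some; rewrite ?normr0; exact: ltr01.
have [x1|x1] := caseE x erefl.
- rewrite /reflection; have [->|x0] := eqVneq x 0.
    by case=> // <-; left; split; rewrite /=; apply/disc_Some; rewrite normr0 ltr01.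
  case=> [[xx]|<- /=].
    have := x1; rewrite -xx normfV norm_conjC -[X in X < _ -> _]mul1r ltr_pdivrMr ?normr_gt0//.
    by rewrite mul1r => /(lt_trans x1); rewrite ltxx.
  left; split; first exact/disc_Some.
  rewrite invr_eq0 conjC_eq0 (negPf x0); apply/disc_Some.
  by rewrite invrK norm_conjC.
- have x0 := big _ x1; rewrite /reflection (negPf x0).
  have xi : `|(x^*)^-1| < 1.
    by rewrite normfV norm_conjC invf_lt1// (lt_trans _ x1)// ltr01.
  case=> [[xx]|<- /=].
    by have := lt_trans x1 (eq_ind _ (fun y => `|y| < 1) xi _ xx); rewrite ltxx.
  right; rewrite (negPf x0); split; apply/disc_Some => //.
  by move: xi; rewrite !normfV norm_conjC.
Qed.

(** With s = 1 + |p|^2, the fixed-point equation makes M proportional to the matrix with rows (s,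
    -2p) and (2 conj p, -s). The relation between x and y is the graph of that map, cleared of
    denominators. *)
Lemma half_turn_swap M (p x y : C) : \det M = 1 -> su11 M -> \tr M = 0 ->
  `|p| < 1 -> mobius M (Some p) = Some p -> `|x| <= 1 ->
  2 * p^* * x * y - (1 + p * p^*) * (x + y) + 2 * p = 0 ->
  mobius M (Some x) = Some y.
Proof.
move=> dM sM t0 p1 /su11_tr0_fix_equation e x1 rel; have {}e := e dM sM t0.
have [dE cE n1] := sM.
have aE : (M ord0 ord0)^* = - M ord0 ord0.
  by rewrite -dE; apply/eqP; rewrite -addr_eq0 addrC -tr2 t0.
have e' := congr1 (fun x : C => x^*) e.
move: e e'; rewrite !expr2 cE !conjE aE => e e'.
apply/mobius_SomeE => //; rewrite cE dE aE.
move: n1; rewrite aE; set a := M ord0 ord0 in aE e e' *.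
set b := M ord0 ord_max in e e' *; move: (b^*) => c in e e' * => n1.
have pp : p * p^* < 1 by rewrite -normCK exprn_ilt1.
have pp1 : 1 - p * p^* != 0 by rewrite subr_eq0 gt_eqF.
have S0 : 0 < 1 + p * p^* by rewrite ltr_pwDl// mul_conjC_ge0.
have cS : c * (1 + p * p^*) = 2 * a * p^*.
  apply: (mulIf pp1); apply/eqP; rewrite -subr_eq0; apply/eqP.
  rewrite -[RHS]oppr0 -[in RHS]e' -[LHS]addr0 -(mulr0 (p^* * p^*)) -e; ring.
have bS : b * (1 + p * p^*) = - 2 * a * p.
  have -> : b = c * (p * p) - 2 * a * p by apply/eqP; rewrite -subr_eq0 -oppr_eq0 -[X in _ == X]e; apply/eqP; ring.
  have -> : (c * (p * p) - 2 * a * p) * (1 + p * p^*) = c * (1 + p * p^*) * (p * p) - 2 * a * p * (1 + p * p^*) by ring.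
  rewrite cS; ring.
have S0' := lt0r_neq0 S0.
apply: (mulIf S0'); apply/eqP; rewrite -subr_eq0; apply/eqP.
have -> : (a * x + b) * (1 + p * p^*) - y * (c * x - a) * (1 + p * p^*) =
  a * x * (1 + p * p^*) + b * (1 + p * p^*) - y * (c * (1 + p * p^*)) * x + a * y * (1 + p * p^*) by ring.
rewrite bS cS -[RHS](mulr0 (- a)) -rel; ring.
Qed.

(** If u = v, the second root [w] of the fixed-point equation coincides with u as well, so the
    discriminant tr^2 - 4 vanishes. *)
Lemma hyperbolic_fixpoints (f : sphere R -> sphere R) (u v : C) :
  hyperbolic f -> fixpoints f = [set Some u; Some v] -> u <> v.
Proof.
move=> [M [dM tM ->]] fE uv; rewrite -{}uv setUid in fE.
have fu : mobius M (Some u) = Some u.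
  by have : fixpoints (mobius M) (Some u) by rewrite fE.
have only z : mobius M z = z -> z = Some u by move=> ?; have : fixpoints (mobius M) z by []; rewrite fE.
have c0 : M ord_max ord0 != 0.
  by apply/negP => /eqP /mobius_None_fix/only.
move/mobius_SomeE in fu; have {}fu := fu dM.
have bE : M ord0 ord_max = u * (M ord_max ord0 * u + M ord_max ord_max) - M ord0 ord0 * u.
  by rewrite -fu; ring.
pose w := (M ord0 ord0 - M ord_max ord_max) / M ord_max ord0 - u.
have wu : w = u.
  suff /only[] : mobius M (Some w) = Some w by [].
  apply/mobius_SomeE => //; apply/eqP; rewrite -subr_eq0; apply/eqP.
  by rewrite bE /w; field.
move: tM dM; rewrite tr2 det2 => tM dM.
have e1 : M ord0 ord0 = 2 * u * M ord_max ord0 + M ord_max ord_max.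
  have : w * M ord_max ord0 = u * M ord_max ord0 by rewrite wu.
  rewrite /w mulrBl mulfVK// => /eqP; rewrite subr_eq subr_eq => /eqP ->; ring.
suff t4 : (M ord0 ord0 + M ord_max ord_max) ^+ 2 = 4 by rewrite t4 ltxx in tM.
by rewrite -[RHS]mulr1 -[X in _ = _ * X]dM bE e1; ring.
Qed.

(** For the denominator D at z, |D|^2 (1 - |w|^2) = 1 - |z|^2 bounds |D| from above, while |b| <=
    |a| gives |D| >= |a| (1 - r). *)
Lemma su11_bound M (r z w : C) : su11 M -> 0 <= r -> r < 1 ->
  `|z| <= r -> `|w| <= r -> mobius M (Some z) = Some w ->
  `|M ord0 ord0| ^+ 2 * ((1 - r) ^+ 2 * (1 - r ^+ 2)) <= 1.
Proof.
move=> [dE cE n1] r0 r1 zr wr; rewrite /mobius; case: ifP => // /negbT D0 [wE].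
move: wE D0; rewrite dE cE; move: (M ord0 ord0) (M ord0 ord_max) n1 => a b n1 wE D0.
set D := b^* * z + a^* in wE D0.
have e1 : D * D^* - (a * z + b) * (a * z + b)^* = 1 - z * z^*.
  by rewrite -[RHS]mul1r -[X in _ = X * _]n1 /D !conjE; ring.
have wD : w * D = a * z + b by rewrite -wE mulfVK.
have e2 : `|D| ^+ 2 * (1 - `|w| ^+ 2) = 1 - `|z| ^+ 2.
  by rewrite !normCK -e1 -wD !conjE; ring.
have rr : 0 < 1 - r ^+ 2 by rewrite subr_gt0 exprn_ilt1.
have le1 : `|D| ^+ 2 * (1 - r ^+ 2) <= 1.
  apply: (@le_trans _ _ (`|D| ^+ 2 * (1 - `|w| ^+ 2))).
    by rewrite ler_wpM2l ?exprn_ge0// lerB// lerXn2r ?nnegrE.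
  by rewrite e2 gerBl exprn_ge0.
apply: le_trans le1; rewrite mulrA ler_wpM2r ?(ltW rr)// -exprMn lerXn2r ?nnegrE//.
  by rewrite mulr_ge0// subr_ge0 ltW.
have ba : `|b| <= `|a|.
  rewrite -(@ler_pXn2r _ 2)// ?nnegrE// !normCK -subr_ge0 n1; exact: ler01.
rewrite mulrBr mulr1 -[`|a|]norm_conjC.
apply: (@le_trans _ _ (`|a^*| - `|b^* * z|)).
  by rewrite lerB// normrM !norm_conjC ler_pM.
rewrite lerBlDr; have {1}-> : a^* = D - b^* * z by rewrite /D; ring.
exact: ler_normB.
Qed.

End HalfTurns.

(** * Topology of the sphere *)

Lemma affine_continuous (K : numFieldType) (a b : K) :
  continuous (fun y : K => a * y + b).
Proof.
move=> x; have bx : cst b @ x --> b by exact: cst_continuous.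
have ax : a * y @[y --> x] --> a * x by exact: mulrl_continuous.
exact: (cvgD ax bx).
Qed.

Section SphereTopology.
Variable R : realType.
Local Notation C := (Cplx R).
Local Notation rc := (fun x : R => (x%:C)%C : C).

Lemma normc_norm (z : C) : `|z| = rc (Normc.normc z).
Proof. by []. Qed.

Lemma normc_opp (z : C) : Normc.normc (- z) = Normc.normc z.
Proof. exact: normcN. Qed.

Lemma rc_le (x y : R) : (rc x <= rc y) = (x <= y).
Proof. exact: lecR. Qed.

Lemma rc_lt (x y : R) : (rc x < rc y) = (x < y).
Proof. exact: ltcR. Qed.

Lemma rc_pos (e : C) : 0 < e -> exists2 x : R, 0 < x & e = rc x.
Proof.
move=> e0; have er : e \is Num.real by rewrite realE ltW.
have eE : e = rc (complex.Re e) by exact: (esym (RRe_real er)).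
by exists (complex.Re e) => //; rewrite -rc_lt -eE.
Qed.

Lemma nbhs_normc (x : C) (U : set C) :
  nbhs x U <-> exists2 e : R, 0 < e & forall y, Normc.normc (x - y) < e -> U y.
Proof.
split=> [/nbhs_ballP[e /= e0 HU]|[e e0 HU]].
  have [e' e'0 eE] := rc_pos e0; exists e' => // y xy; apply: HU.
  by rewrite -ball_normE /= eE normc_norm rc_lt.
apply/nbhs_ballP; exists (rc e); first by rewrite /= (rc_lt 0).
by move=> y; rewrite -ball_normE /= normc_norm rc_lt; exact: HU.
Qed.

Lemma normc_continuous : continuous (@Normc.normc R : C -> R).
Proof.
move=> x U /nbhs_ballP[e /= e0 HU]; apply/nbhs_normc; exists e => // y xy.
apply: HU; rewrite -ball_normE /=; apply: le_lt_trans xy; rewrite ler_norml.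
have trg (a b : C) : Normc.normc a - Normc.normc b <= Normc.normc (a - b).
  have := ler_normD (a - b) b; rewrite subrK !normc_norm -rmorphD rc_le.
  by rewrite lerBlDr.
rewrite trg andbT lerNl opprB.
by have := trg y x; rewrite -[X in _ <= X]normc_opp opprB.
Qed.

Lemma complex_pair_continuous : continuous (fun p : R * R => Complex p.1 p.2 : C).
Proof.
move=> p; apply/cvgrPdist_lt => e e0; have [e' e'0 ->] := rc_pos e0.
have e2 : 0 < e' / 2 by rewrite divr_gt0.
near=> q.
have q1 : `|p.1 - q.1| < e' / 2 by near: q; apply: cvgr_dist_lt => //; exact: cvg_fst.
have q2 : `|p.2 - q.2| < e' / 2 by near: q; apply: cvgr_dist_lt => //; exact: cvg_snd.
have -> : Complex p.1 p.2 - Complex q.1 q.2 = rc (p.1 - q.1) + 'i * rc (p.2 - q.2) :> C.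
  by rewrite [LHS]complexE complexiE.
apply: le_lt_trans (ler_normD _ _) _.
rewrite normrM normCi mul1r.
have nrc (x : R) : `|rc x| = rc `|x|.
  by rewrite normc_norm /Normc.normc /= expr0n /= addr0 sqrtr_sqr.
rewrite !nrc -rmorphD rc_lt; lra.
Unshelve. all: by end_near. Qed.

Lemma closed_ball_closed (r : R) : closed [set z : C | Normc.normc z <= r].
Proof.
apply: (@closed_comp _ _ (@Normc.normc R : C -> R) [set x | x <= r]).
  by move=> x _; exact: normc_continuous.
exact: closed_le.
Qed.

Lemma closed_ball_compact (r : R) : compact [set z : C | Normc.normc z <= r].
Proof.
apply: (@subclosed_compact _ _
  ((fun p : R * R => Complex p.1 p.2 : C) @` (`[- r, r] `*` `[- r, r]))).
- exact: closed_ball_closed.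
- apply: continuous_compact; last by apply: compact_setX; exact: segment_compact.
  by apply: continuous_subspaceT; exact: complex_pair_continuous.
move=> [x y] /= le; exists (x, y) => //=.
have sq (a b : R) : Num.sqrt (a ^+ 2 + b ^+ 2) <= r -> `|a| <= r.
  by apply: le_trans; rewrite -sqrtr_sqr ler_sqrt ?lerDl ?sqr_ge0// addr_ge0 ?sqr_ge0.
have := sq _ _ le; rewrite addrC in le; have := sq _ _ le.
by rewrite !ler_norml !in_itv /= => -> ->.
Qed.

Lemma compact_norm_bounded (K : set C) : compact K ->
  exists2 N : R, 0 < N & forall z, K z -> Normc.normc z <= N.
Proof.
move=> cK; have := @continuous_compact _ _ (@Normc.normc R : C -> R) K _ cK.
case/(_ _)/compact_bounded; first by apply: continuous_subspaceT; exact: normc_continuous.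
move=> M [_ HM]; pose N := Num.max M 0 + 1.
have MN : M < N by rewrite /N ltr_pwDr// le_max lexx.
have N0 : 0 < N by rewrite /N ltr_pwDr// le_max lexx orbT.
exists N => // z Kz.
have : `|Normc.normc z| <= N by apply: (HM N MN); exists z.
by apply: le_trans; exact: ler_norm.
Qed.

Lemma nbhs_Some (x : C) (U : set (sphere R)) :
  nbhs (Some x : sphere R) U <-> nbhs x (Some @^-1` U).
Proof. by []. Qed.

Lemma nbhs_None (U : set (sphere R)) : nbhs (None : sphere R) U <->
  U None /\ exists2 N : R, 0 < N & forall z : C, N < Normc.normc z -> U (Some z).
Proof.
split=> [[K [cK _] KU]|[UN [N N0 HN]]].
  split; first by apply: KU; right.
  have [N N0 HN] := compact_norm_bounded cK; exists N => // z Nz.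
  apply: KU; left; exists z => // /HN; by rewrite leNgt Nz.
exists [set z : C | Normc.normc z <= N].
  by split; [exact: closed_ball_compact|exact: closed_ball_closed].
move=> _ [[z nz <-]|->//]; apply: HN; rewrite ltNge; exact/negP.
Qed.

Lemma sphere_inv_involutive : involutive (@sphere_inv R).
Proof.
case=> [x|] /=; last by rewrite eqxx.
by case: eqP => [->//|/eqP x0] /=; rewrite invr_eq0 (negPf x0) invrK.
Qed.

Lemma normc_inv (z : C) : Normc.normc z^-1 = (Normc.normc z)^-1.
Proof. exact: Normc.normcV. Qed.

Lemma normc_gt0 (z : C) : (0 < Normc.normc z) = (z != 0).
Proof. by rewrite -(rc_lt 0) -normc_norm normr_gt0. Qed.

Lemma neq0_near (x : C) : x != 0 -> \forall y \near x, y != 0.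
Proof.
move=> x0; apply/nbhs_normc; exists (Normc.normc x); first by rewrite normc_gt0.
by move=> y; apply: contraTneq => ->; rewrite subr0 -leNgt.
Qed.

Lemma sphere_inv_continuous : continuous (@sphere_inv R).
Proof.
case=> [x|]; last first.
  move=> U /nbhs_Some/nbhs_normc[e e0 HU]; apply/nbhs_None; split.
    by apply: HU; rewrite subrr Normc.normc0.
  exists e^-1; rewrite ?invr_gt0// => z ez.
  have z0 : z != 0 by rewrite -normc_gt0 (lt_trans _ ez)// invr_gt0.
  rewrite /= (negPf z0); apply: HU; rewrite sub0r normc_opp normc_inv.
  by rewrite invf_plt ?posrE// normc_gt0.
have [->|x0] := eqVneq x 0.
  move=> U; rewrite /= eqxx => /nbhs_None[UN [N N0 HN]].
  apply/nbhs_Some/nbhs_normc; exists N^-1; rewrite ?invr_gt0// => y.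
  rewrite sub0r normc_opp /= => yN; case: eqP => [_//|/eqP y0]; apply: HN.
  by rewrite normc_inv -[N]invrK ltf_pV2 ?posrE ?normc_gt0 ?invr_gt0.
move=> U; rewrite /= (negPf x0) => /nbhs_Some HU; apply/nbhs_Some.
near=> y; have y0 : y != 0.
  by near: y; exact: neq0_near.
rewrite /= (negPf y0); near: y.
exact: (inv_continuous x0 HU).
Unshelve. all: by end_near. Qed.

Lemma mobius_finite_near (M : 'M[C]_2) (x : C) : mobius M (Some x) <> None ->
  \forall y \near x, mobius M (Some y) = Some ((M ord0 ord0 * y + M ord0 ord_max) /
     (M ord_max ord0 * y + M ord_max ord_max)).
Proof.
rewrite /=; case: ifP => // /negbT D0 _; near=> y.
have Dy : M ord_max ord0 * y + M ord_max ord_max != 0.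
  near: y; exact: (@affine_continuous C _ _ _ _ (neq0_near D0)).
by rewrite (negPf Dy).
Unshelve. all: by end_near. Qed.

Lemma mobius_continuous_finite (M : 'M[C]_2) (x : C) : mobius M (Some x) <> None ->
  {for (Some x : sphere R), continuous (mobius M)}.
Proof.
move=> Mx U; have near_x := mobius_finite_near Mx.
have [D0 ->] : M ord_max ord0 * x + M ord_max ord_max != 0 /\
    mobius M (Some x) = Some ((M ord0 ord0 * x + M ord0 ord_max) /
     (M ord_max ord0 * x + M ord_max ord_max)).
  by move: Mx; rewrite /mobius; case: ifP => // /negbT.
move=> /nbhs_Some HU.
apply/nbhs_Some; near=> y.
have My : mobius M (Some y) = Some ((M ord0 ord0 * y + M ord0 ord_max) /
     (M ord_max ord0 * y + M ord_max ord_max)) by near: y.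
change (U (mobius M (Some y))); rewrite My.
near: y; move: HU.
have affine (a b : C) := @affine_continuous C a b x.
exact: (cvgM (affine _ _) (continuous_cvg _ (inv_continuous D0) (affine _ _))).
Unshelve. all: by end_near. Qed.

Lemma sphere_invE : @sphere_inv R = mobius (mx2 0 1 1 0).
Proof.
apply/funext => -[x|]; rewrite /mobius !mx2E /=.
  by rewrite !mul0r !mul1r add0r addr0 div1r.
by rewrite oner_eq0 divr1.
Qed.

Definition chart_matrix (c : sphere R -> sphere R) (P : 'M[C]_2) :=
  [/\ \det P != 0, c = mobius P, involutive c & continuous c].

Lemma chart_matrixP c : [set idfun; @sphere_inv R] c -> exists P, chart_matrix c P.
Proof.
case=> ->.
  exists 1%:M; split => //; first by rewrite det1 oner_neq0.
    by rewrite mobius_scalar// oner_neq0.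
  by move=> z; exact: cvg_id.
exists (mx2 0 1 1 0); split.
- by rewrite det2 !mx2E mul0r mul1r sub0r oppr_eq0 oner_neq0.
- exact: sphere_invE.
- exact: sphere_inv_involutive.
- exact: sphere_inv_continuous.
Qed.

Lemma exists_chart (z : sphere R) :
  exists2 c, [set idfun; @sphere_inv R] c & c z <> None.
Proof. by case: z => [x|]; [exists idfun; [left|]|exists (@sphere_inv R); [right|]]. Qed.

Lemma mobius_in_charts (M P Q : 'M[C]_2) c d : \det M != 0 ->
  chart_matrix c P -> chart_matrix d Q ->
  d \o mobius M \o c = mobius (Q *m M *m P).
Proof.
move=> dM [dP cE _ _] [dQ dE _ _].
by rewrite mobius_comp// mobius_comp// -cE -dE.
Qed.

(** Charts on both sides bring the point and its image to finite points; being involutions, they can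
    be undone afterwards. *)
Lemma mobius_continuous (M : 'M[C]_2) : \det M != 0 -> continuous (mobius M).
Proof.
move=> dM z; have [c cc cz] := exists_chart z; have [d cd dz] := exists_chart (mobius M z).
have [P cP] := chart_matrixP cc; have [Q dQ] := chart_matrixP cd.
have NE := mobius_in_charts dM cP dQ.
have [_ _ cK c_cont] := cP; have [_ _ dK d_cont] := dQ.
have -> : mobius M = d \o mobius (Q *m M *m P) \o c.
  by rewrite -NE; apply/funext => y /=; rewrite cK dK.
apply: continuous_comp; first exact: c_cont.
apply: continuous_comp; last exact: d_cont.
case E : (c z) cz => [x|] // _; apply: mobius_continuous_finite.
by rewrite -NE /= -E cK.
Qed.

Lemma mobius_derivable (M : 'M[C]_2) (x : C) : mobius M (Some x) <> None ->
  derivable (fun y : C => finite_part (mobius M (Some y))) x 1.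
Proof.
move=> Mx; have near_x := mobius_finite_near Mx.
apply: (@near_eq_derivable _ _ _ (fun y : C => (M ord0 ord0 * y + M ord0 ord_max) /
     (M ord_max ord0 * y + M ord_max ord_max))).
  near=> y; have My : mobius M (Some y) = Some ((M ord0 ord0 * y + M ord0 ord_max) /
     (M ord_max ord0 * y + M ord_max ord_max)) by near: y.
  by rewrite My.
have affine (a b : C) : derivable (fun y : C => a * y + b) x 1.
  apply: derivableD; last exact: derivable_cst.
  by apply: derivableM; [exact: derivable_cst|exact: derivable_id].
apply: derivableM; first exact: affine.
apply: derivableV; last exact: affine.
by move: Mx; rewrite /mobius; case: ifP => // /negbT.
Unshelve. all: by end_near. Qed.

Lemma mobius_holomorphic (M : 'M[C]_2) (z : sphere R) : \det M != 0 ->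
  holomorphic_at (mobius M) z.
Proof.
move=> dM; split; first exact: mobius_continuous.
move=> c d cc cd cz dz.
have [P cP] := chart_matrixP cc; have [Q dQ] := chart_matrixP cd.
have NE := mobius_in_charts dM cP dQ; have [_ _ cK _] := cP.
have -> : (fun x : C => finite_part (d (mobius M (c (Some x))))) =
   (fun x : C => finite_part (mobius (Q *m M *m P) (Some x))).
  by rewrite -NE.
apply: mobius_derivable; rewrite -NE /=.
by case E : (c z) cz => [x|] // _; rewrite /= -E cK.
Qed.

End SphereTopology.

(** * The set of discontinuity *)

(** A pigeonhole form of total boundedness: the code of x is the index of the cell of width [eta]
    containing it, counted from -K. *)
Lemma bounded_real_code (R : realType) (K eta : R) : 0 < eta ->
  exists m (code : R -> 'I_m.+1), forall x y, `|x| <= K -> `|y| <= K ->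
    code x = code y -> `|x - y| < eta.
Proof.
move=> e0; exists (Num.truncn ((K + K) / eta)).
exists (fun x => inord (Num.truncn ((x + K) / eta))) => x y xK yK.
have pos z : `|z| <= K -> 0 <= (z + K) / eta.
  by rewrite ler_norml => /andP[? _]; rewrite divr_ge0 ?(ltW e0)//; lra.
have lt z : `|z| <= K -> (Num.truncn ((z + K) / eta) < (Num.truncn ((K + K) / eta)).+1)%N.
  move=> zK; rewrite ltnS le_truncn// ler_pM2r ?invr_gt0//.
  by move: zK; rewrite ler_norml => /andP[_ ?]; lra.
move=> /(congr1 val) /=; rewrite !inordK ?lt// => txy.
have /andP[x1 x2] := truncn_itv (pos x xK); have /andP[y1 y2] := truncn_itv (pos y yK).
rewrite -txy -natr1 in y1 y2; rewrite -natr1 in x2.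
have : `|(x + K) / eta - (y + K) / eta| < 1.
  by rewrite ltr_norml; apply/andP; split; lra.
rewrite -mulrBl normrM normfV (gtr0_norm e0) ltr_pdivrMr// mul1r.
by rewrite opprD addrACA subrr addr0.
Qed.

Section Discontinuity.
Variable R : realType.
Local Notation C := (Cplx R).
Local Notation rc := (fun x : R => (x%:C)%C : C).
Implicit Types (G : set (sphere R -> sphere R)) (M N : 'M[C]_2).

Lemma Omega_open G : open (Omega G).
Proof.
rewrite openE => z [U /nbhs_interior zU fU].
by apply: filterS zU => w wU; exists U.
Qed.

(** Used twice: with a half-turn, which normalizes the group, and with 1/z, which exchanges the disc
    and the exterior. *)
Lemma Omega_conj G (phi : sphere R -> sphere R) (z : sphere R) :
  involutive phi -> continuous phi ->
  Omega [set g : sphere R -> sphere R | G (phi \o g \o phi)] z -> Omega G (phi z).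
Proof.
move=> phiK cphi [U zU fU]; exists (phi @^-1` U).
  by apply: (cphi (phi z)); rewrite phiK.
pose F (g : sphere R -> sphere R) := phi \o g \o phi.
have FK : involutive F by move=> g; apply/funext => y; rewrite /F /= !phiK.
rewrite (_ : [set _ | _] = F @^-1` [set g | G (F g) /\ g @` U `&` U !=set0]).
  by apply: finite_preimage => //; apply: in2W; exact: can_inj FK.
apply/seteqP; split=> g /=; rewrite FK.
  move=> [Gg [_ [[y Uy <-] Ugy]]]; split => //; exists (phi (g y)); split => //.
  by exists (phi y) => //; rewrite /F /= phiK.
move=> [Gg [_ [[y Uy <-] Ugy]]]; split => //; exists (g (phi y)); split => //.
by exists (phi y) => //=; rewrite phiK.
Qed.

Lemma Omega_finite_stab G z : Omega G z -> finite_set [set g | G g /\ g z = z].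
Proof.
move=> [U zU fU]; apply: sub_finite_set fU => g [Gg gz]; split => //.
by exists z; split; [exists z|]; rewrite ?gz//; exact: nbhs_singleton.
Qed.

Lemma normc_ge0 (z : C) : 0 <= Normc.normc z.
Proof. by case: z => a b; exact: sqrtr_ge0. Qed.

Lemma normc_Re_Im (z : C) :
  `|complex.Re z| <= Normc.normc z /\ `|complex.Im z| <= Normc.normc z.
Proof.
case: z => a b /=; rewrite -!sqrtr_sqr !ler_sqrt ?addr_ge0 ?sqr_ge0//.
by rewrite lerDl lerDr !sqr_ge0.
Qed.

Lemma normc_le_Re_Im (z : C) :
  Normc.normc z <= `|complex.Re z| + `|complex.Im z|.
Proof.
case: z => a b /=; rewrite -[leRHS]ger0_norm ?addr_ge0// -sqrtr_sqr.
rewrite ler_sqrt ?sqr_ge0// sqrrD !real_normK ?num_real//.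
by rewrite -addrA lerD2l lerDr mulrn_wge0// mulr_ge0.
Qed.

(** P is M N^-1, with the explicit inverse of SU(1,1), and P - 1 = (M - N) N^-1 is small when M - N
    is small and N bounded. *)
Lemma su11_close M N (K eta : C) : su11 M -> su11 N ->
  `|N ord0 ord0| <= K -> `|N ord0 ord_max| <= K ->
  `|M ord0 ord0 - N ord0 ord0| < eta ->
  `|M ord0 ord_max - N ord0 ord_max| < eta ->
  exists2 P, \det P = 1 /\ M = P *m N &
    forall i j, `|P i j - 1%:M i j| <= eta * K + eta * K.
Proof.
move=> [dM cM nM] [dN cN nN] aK bK ae be.
set a := M ord0 ord0 in dM nM ae *; set b := M ord0 ord_max in cM nM be *.
set a' := N ord0 ord0 in dN nN ae aK *; set b' := N ord0 ord_max in cN nN be bK *.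
exists (mx2 (a * a'^* - b * b'^*) (b * a' - a * b')
            (b^* * a'^* - a^* * b'^*) (a^* * a' - b^* * b')).
  split.
    rewrite det2 !mx2E -[RHS]mulr1 -[in X in _ = X * _]nM -[X in _ = _ * X]nN; ring.
  apply/matrixP; apply: ord2P; apply: ord2P; rewrite mul2E !mx2E ?dM ?cM ?dN ?cN
    -/a -/b -/a' -/b'.
  - by rewrite -[LHS]mulr1 -[X in _ * X = _]nN; ring.
  - by rewrite -[LHS]mulr1 -[X in _ * X = _]nN; ring.
  - by rewrite -[LHS]mulr1 -[X in _ * X = _]nN; ring.
  - by rewrite -[LHS]mulr1 -[X in _ * X = _]nN; ring.
have bound (x y x' y' : C) : `|x| < eta -> `|y| < eta -> `|x'| <= K -> `|y'| <= K ->
    `|x * x' - y * y'| <= eta * K + eta * K.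
  move=> xe ye x'K y'K; rewrite (le_trans (ler_normB _ _))// !normrM.
  by rewrite lerD// ler_pM// ltW.
have conj_lt (x y : C) : `|x - y| < eta -> `|x^* - y^*| < eta.
  by rewrite -[x^* - y^*](rmorphB (@Num.conj C)) norm_conjC.
apply: ord2P; apply: ord2P; rewrite !mx2E mxE /= ?mulr1n ?mulr0n ?subr0.
- have -> : a * a'^* - b * b'^* - 1 = (a - a') * a'^* - (b - b') * b'^*.
    by rewrite -[X in _ - X]nN; ring.
  by apply: bound; rewrite ?norm_conjC.
- have -> : b * a' - a * b' = (b - b') * a' - (a - a') * b' by ring.
  exact: bound.
- have -> : b^* * a'^* - a^* * b'^* = (b^* - b'^*) * a'^* - (a^* - a'^*) * b'^* by ring.
  by apply: bound; rewrite ?norm_conjC//; exact: conj_lt.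
- have -> : a^* * a' - b^* * b' - 1 = (a^* - a'^*) * a' - (b^* - b'^*) * b'.
    by rewrite -[X in _ - X]nN; ring.
  by apply: bound => //; exact: conj_lt.
Qed.

(* The elements of G that move a small disc onto one meeting it have bounded
   matrices; when two of these have close entries, their quotient is close to
   the identity, so that they are equal by discreteness. *)
Lemma disc_sub_Omega G :
  (forall g, G g -> exists M, [/\ \det M = 1, su11 M & g = mobius M]) ->
  (forall g h, G g -> G h -> exists2 k, G k & k \o h = g) ->
  discrete G -> disc R `<=` Omega G.
Proof.
move=> GM Gdiv [e' e'0 dG] _ [z0 z01 <-].
have [e e0 eE] := rc_pos e'0; rewrite {}eE in dG => {e' e'0}.
move: z01 => /=; rewrite normc_norm (rc_lt _ 1) => z01.
pose r := (1 + Normc.normc z0) / 2.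
have n0 := normc_ge0 z0.
have r0 : 0 < r by rewrite /r; lra.
have r1 : r < 1 by rewrite /r; lra.
pose U : set (sphere R) := Some @` [set z : C | Normc.normc z < r].
exists U.
  apply/nbhs_Some/nbhs_normc; exists (r - Normc.normc z0); first by rewrite /r; lra.
  move=> y yz; exists y => //=.
  have := ler_normB z0 (z0 - y); rewrite opprB addrC subrK !normc_norm -rmorphD rc_le.
  by move=> ?; lra.
set S := [set g | _ /\ _].
pose k := (1 - r) ^+ 2 * (1 - r ^+ 2).
have k0 : 0 < k by rewrite mulr_gt0 ?exprn_gt0 ?subr_gt0// exprn_ilt1// ltW.
(* [su11_bound] gives |a|^2 k <= 1, and |b| <= |a|, so [K] bounds all entries. *)
pose K := Num.sqrt k^-1.
have K0 : 0 < K by rewrite sqrtr_gt0 invr_gt0.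
(* Membership in [S] stays under the existential so that [choice] yields a matrix for every map. *)
have SM g : exists M, S g -> [/\ \det M = 1, g = mobius M, su11 M,
    Normc.normc (M ord0 ord0) <= K & Normc.normc (M ord0 ord_max) <= K].
  have [[Gg [w [[_ [z zr <-] gzw] [w' w'r w'w]]]]|nS] := pselect (S g); last first.
    by exists 0 => /nS.
  have [M [dM sM gM]] := GM g Gg; exists M => _; rewrite {}gM -{}w'w in gzw *.
  have := @su11_bound R M (rc r) z w' sM; rewrite !normc_norm (rc_le 0) (rc_lt _ 1) !rc_le.
  move=> /(_ (ltW r0) r1 (ltW zr) (ltW w'r) gzw).
  have -> : rc (Normc.normc (M ord0 ord0)) ^+ 2 * ((1 - rc r) ^+ 2 * (1 - rc r ^+ 2)) =
      rc (Normc.normc (M ord0 ord0) ^+ 2 * k).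
    by rewrite /k !(rmorphM, rmorphB, rmorphXn, rmorph1).
  rewrite (rc_le _ 1) => bnd.
  have aK : Normc.normc (M ord0 ord0) <= K.
    rewrite -(@ler_pXn2r _ 2)// ?nnegrE ?(ltW K0) ?normc_ge0//.
    by rewrite sqr_sqrtr ?invr_ge0 ?(ltW k0)// -[leRHS]mul1r ler_pdivlMr.
  split => //; apply: le_trans aK; rewrite -rc_le -!normc_norm.
  have [_ _ nM] := sM.
  rewrite -(@ler_pXn2r _ 2)// ?nnegrE// !normCK -subr_ge0 nM; exact: ler01.
have [mat matP] := choice SM.
(* Equal codes bring entries within 2 eta, hence the quotient within 4 eta K = e / 2 of the
   identity. *)
pose eta := e / (8 * K); have eta0 : 0 < eta by rewrite divr_gt0// mulr_gt0.
have [m [code codeP]] := bounded_real_code K eta0.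
pose codeM g := let a := mat g ord0 ord0 in let b := mat g ord0 ord_max in
  ((code (complex.Re a), code (complex.Im a)),
   (code (complex.Re b), code (complex.Im b))).
have close (x y : C) : Normc.normc x <= K -> Normc.normc y <= K ->
    code (complex.Re x) = code (complex.Re y) ->
    code (complex.Im x) = code (complex.Im y) -> `|x - y| < rc (2 * eta).
  move=> xK yK /codeP re /codeP im.
  have [x1 x2] := normc_Re_Im x; have [y1 y2] := normc_Re_Im y.
  have {}re := re (le_trans x1 xK) (le_trans y1 yK).
  have {}im := im (le_trans x2 xK) (le_trans y2 yK).
  rewrite normc_norm rc_lt (le_lt_trans (normc_le_Re_Im _))//.
  by move: re im; rewrite -!raddfB /= => re im; rewrite mulr_natl mulr2n ltrD.
have inj : {in S &, injective codeM}.
  move=> g h; rewrite !inE => Sg Sh [a1 a2 b1 b2].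
  have [dg gE sg ag bg] := matP g Sg; have [dh hE sh ah bh] := matP h Sh.
  have ca := close _ _ ag ah a1 a2; have cb := close _ _ bg bh b1 b2.
  have ah' : `|mat h ord0 ord0| <= rc K by rewrite normc_norm rc_le.
  have bh' : `|mat h ord0 ord_max| <= rc K by rewrite normc_norm rc_le.
  have [P [dP gPh] Pclose] := su11_close sg sh ah' bh' ca cb.
  have PE : mobius P \o h = g.
    by rewrite [in LHS]hE -mobius_comp ?dh ?oner_neq0// -gPh -gE.
  have [k' Gk' kE] := Gdiv g h Sg.1 Sh.1.
  (* Both maps carry [h] to [g], and [h] is onto; so discreteness applies to [P]. *)
  have Pk : mobius P = k'.
    have hs : exists h', cancel h' h.
      exists (mobius (invmx (mat h))).
      have := @mobiusK R (invmx (mat h)); rewrite invmxK -hE; apply.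
      by rewrite det_inv dh invr1 oner_neq0.
    have [h' h'K] := hs; apply/funext => z; rewrite -(h'K z).
    by have := congr1 (fun f => f (h' z)) PE; rewrite /= => ->; rewrite -kE.
  have /dG : \det P = 1 by [].
  rewrite Pk => /(_ _ Gk') Pid; rewrite -kE Pid//.
  move=> i j; apply: le_lt_trans (Pclose i j) _.
  rewrite -!rmorphM -!rmorphD rc_lt /eta.
  have -> : 2 * (e / (8 * K)) * K + 2 * (e / (8 * K)) * K = e / 2.
    by field; rewrite gt_eqF.
  by rewrite ltr_pdivrMr//; lra.
by rewrite -(eq_finite_set (inj_card_eq inj)); exact: finite_finset.
Qed.

End Discontinuity.

(** * The axis of a hyperbolic transformation *)

Lemma cvg_bilinear (K : numFieldType) (T : Type) (F : set_system T)
    (FF : Filter F) (f g : T -> K) (u v c s d : K) :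
  f @ F --> u -> g @ F --> v ->
  c * f x * g x - s * (f x + g x) + d @[x --> F] --> c * u * v - s * (u + v) + d.
Proof.
move=> fu gv; apply: cvgD; last exact: cvg_cst.
apply: cvgB; first by apply: cvgM => //; apply: cvgM => //; exact: cvg_cst.
by apply: cvgM; [exact: cvg_cst|exact: cvgD].
Qed.

Section Axis.
Variable R : realType.
Local Notation C := (Cplx R).
Local Notation rc := (fun x : R => (x%:C)%C : C).

(** The pseudo-hyperbolic distance, tanh of half of [hyp_dist]. *)
Definition pseudo_dist (z w : C) : R :=
  Normc.normc (z - w) / Normc.normc (1 - w^* * z).

Lemma disc_denominator (z w : C) : `|z| < 1 -> `|w| < 1 -> 1 - w^* * z != 0.
Proof.
move=> z1 w1; rewrite subr_eq0; apply/negP => /eqP e.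
have : `|w^* * z| < 1 by rewrite normrM norm_conjC mulr_ilt1.
by rewrite -e normr1 ltxx.
Qed.

Lemma pseudo_distE (z w : C) : `|z| < 1 -> `|w| < 1 ->
  `|z - w| = rc (pseudo_dist z w) * `|1 - w^* * z|.
Proof.
move=> z1 w1; have d0 := disc_denominator z1 w1.
by rewrite /pseudo_dist !normc_norm -rmorphM mulfVK// gt_eqF// normc_gt0.
Qed.

Lemma pseudo_dist_ge0 (z w : C) : 0 <= pseudo_dist z w.
Proof. by rewrite /pseudo_dist divr_ge0// normc_ge0. Qed.

Lemma pseudo_dist_lt1 (z w : C) : `|z| < 1 -> `|w| < 1 -> pseudo_dist z w < 1.
Proof.
move=> z1 w1; have d0 := disc_denominator z1 w1.
rewrite /pseudo_dist ltr_pdivrMr ?normc_gt0// mul1r -rc_lt -!normc_norm.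
rewrite ltr_normCK !conjE -subr_gt0.
have -> : (1 - w^* * z) * (1 - w * z^*) - (z - w) * (z^* - w^*) =
  (1 - z * z^*) * (1 - w * w^*) by ring.
by rewrite mulr_gt0// subr_gt0 -normCK exprn_ilt1.
Qed.

Lemma ln_ratio_inj (r s : R) : 0 <= r < 1 -> 0 <= s < 1 ->
  ln ((1 + r) / (1 - r)) = ln ((1 + s) / (1 - s)) -> r = s.
Proof.
move=> /andP[r0 r1] /andP[s0 s1] e.
have : (1 + r) / (1 - r) = (1 + s) / (1 - s).
  by apply: ln_inj e; rewrite posrE divr_gt0//; lra.
move/eqP; rewrite eqr_div; [|lra|lra].
by move/eqP => ?; lra.
Qed.

(** The duplication formula of tanh. *)
Lemma ln_ratio_double (r s : R) : 0 <= r < 1 -> 0 <= s < 1 ->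
  ln ((1 + r) / (1 - r)) = ln ((1 + s) / (1 - s)) *+ 2 ->
  r * (1 + s ^+ 2) = 2 * s.
Proof.
move=> /andP[r0 r1] /andP[s0 s1]; rewrite -lnXn; last by rewrite divr_gt0; lra.
move=> e; have : (1 + r) / (1 - r) = ((1 + s) / (1 - s)) ^+ 2.
  by apply: ln_inj e; rewrite posrE ?exprn_gt0// divr_gt0//; lra.
rewrite expr_div_n => /eqP; rewrite eqr_div; [|lra|]; last by rewrite expf_neq0//; lra.
by move/eqP => ?; lra.
Qed.

(** The case of equality in the triangle inequality through the centre 0. Once squared, the
    hypothesis is linear in X = 2 Re (al conj be) and forces X = -2 s^2, that is |al + be|^2 = 0. *)
Lemma equidistant_antipodal (al be s : C) : s^* = s -> 1 - s ^+ 2 != 0 ->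
  `|al| = s -> `|be| = s ->
  `|al - be| * (1 + s ^+ 2) = 2 * s * `|1 - be^* * al| -> al + be = 0.
Proof.
move=> sr s1 als bes e.
have aa : al * al^* = s ^+ 2 by rewrite -normCK als.
have bb : be * be^* = s ^+ 2 by rewrite -normCK bes.
have {}e : (al - be) * (al - be)^* * (1 + s ^+ 2) ^+ 2 =
    4 * s ^+ 2 * ((1 - be^* * al) * (1 - be^* * al)^*).
  by rewrite -!normCK -exprMn e; ring.
move: aa bb e s1; rewrite !conjE; set q := s ^+ 2 => aa bb e s1.
apply/eqP; rewrite -normr_eq0 -sqrf_eq0 normCK conjE; apply/eqP.
apply: (mulIf (expf_neq0 2 s1)); rewrite mul0r.
pose X := al * be^* + be * al^*.
have e1 : (al - be) * (al^* - be^*) = 2 * q - X.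
  by rewrite /X mulr_natl mulr2n -{1}aa -bb; ring.
have e2 : (1 - be^* * al) * (1 - be * al^*) = 1 - X + q ^+ 2.
  by rewrite /X expr2 -{1}aa -bb; ring.
have e3 : (al + be) * (al^* + be^*) = 2 * q + X.
  by rewrite /X mulr_natl mulr2n -{1}aa -bb; ring.
rewrite e1 e2 in e; rewrite e3.
have -> : (2 * q + X) * (1 - q) ^+ 2 =
   4 * q * (1 - X + q ^+ 2) - (2 * q - X) * (1 + q) ^+ 2 by ring.
by rewrite e subrr.
Qed.

(** The isometry z -> (z - p) / (1 - conj p z) moves p to 0 and makes the images of a and b
    antipodal. Clearing denominators in their zero sum gives the relation. *)
Lemma hyperbolic_midpoint (a b p : C) (t : R) :
  `|a| < 1 -> `|b| < 1 -> `|p| < 1 ->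
  hyp_dist a p = t -> hyp_dist b p = t -> hyp_dist a b = t *+ 2 ->
  2 * p^* * a * b - (1 + p * p^*) * (a + b) + 2 * p = 0.
Proof.
move=> a1 b1 p1; rewrite /hyp_dist -!/(pseudo_dist _ _) => ta tb tab.
have ra : 0 <= pseudo_dist a p < 1 by rewrite pseudo_dist_ge0 pseudo_dist_lt1.
have rb : 0 <= pseudo_dist b p < 1 by rewrite pseudo_dist_ge0 pseudo_dist_lt1.
have rab : 0 <= pseudo_dist a b < 1 by rewrite pseudo_dist_ge0 pseudo_dist_lt1.
have sE : pseudo_dist b p = pseudo_dist a p by apply: ln_ratio_inj; rewrite // ta tb.
have := ln_ratio_double rab ra; rewrite ta => /(_ tab).
have := pseudo_distE a1 p1; have := pseudo_distE b1 p1; have := pseudo_distE a1 b1.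
rewrite sE; move: ra; set s := pseudo_dist a p; set r := pseudo_dist a b.
move=> /andP[s0 s1] dab db da /(congr1 rc) rs.
have {rs} : rc r * (1 + rc s ^+ 2) = 2 * rc s.
  by move: rs; rewrite !(rmorphM, rmorphD, rmorphXn, rmorph1, rmorph_nat).
move: dab db da; set S := rc s; set T := rc r => dab db da rs.
have S1 : 1 - S ^+ 2 != 0.
  rewrite subr_eq0 eq_sym lt_eqF//.
  by rewrite -rmorphXn (rc_lt _ 1) exprn_ilt1.
have Sr : S^* = S by apply/CrealP; apply/complex_realP; exists s.
have na := disc_denominator a1 p1; have nb := disc_denominator b1 p1.
have nb' : 1 - p * b^* != 0.
  by have := nb; rewrite -(conjC_eq0 (1 - p^* * b)) !conjE.
have pp : 1 - p * p^* != 0.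
  by rewrite subr_eq0 eq_sym lt_eqF// -normCK exprn_ilt1.
have : (a - p) / (1 - p^* * a) + (b - p) / (1 - p^* * b) = 0.
  apply: (equidistant_antipodal Sr S1).
  - by rewrite normf_div da mulfK// normr_eq0.
  - by rewrite normf_div db mulfK// normr_eq0.
  have cE : ((b - p) / (1 - p^* * b))^* = (b^* - p^*) / (1 - p * b^*).
    by rewrite [LHS](fmorph_div (@Num.conj C)) /= !conjE.
  have e1 : (a - p) / (1 - p^* * a) - (b - p) / (1 - p^* * b) =
      (a - b) * (1 - p * p^*) / ((1 - p^* * a) * (1 - p^* * b)).
    by field; rewrite na nb.
  have e2 : 1 - ((b - p) / (1 - p^* * b))^* * ((a - p) / (1 - p^* * a)) =
      (1 - b^* * a) * (1 - p * p^*) / ((1 - p^* * a) * (1 - p * b^*)).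
    by rewrite cE; field; rewrite na nb'.
  have nn : `|1 - p * b^*| = `|1 - p^* * b|.
    by rewrite -[LHS]norm_conjC !conjE.
  rewrite e1 e2 !normf_div !normrM nn dab.
  set u := `|1 - b^* * a|; set v := `|1 - p * p^*|; set w := (_ * _)^-1.
  have -> : T * u * v * w * (1 + S ^+ 2) = T * (1 + S ^+ 2) * (u * v * w) by ring.
  by rewrite rs; ring.
move=> /(congr1 (fun x => - (x * ((1 - p^* * a) * (1 - p^* * b))))).
rewrite mul0r oppr0 => <-; field; by rewrite na nb.
Qed.

(** The point at time t0 is the midpoint of those at t0 - h and t0 + h. The midpoint relation holds
    for all h > 0, hence in the limit at the two ends. *)
Lemma axis_midpoint (f : sphere R -> sphere R) (z : sphere R) : axis f z ->
  exists p u v : C, [/\ z = Some p, `|p| < 1, `|u| <= 1 & `|v| <= 1] /\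
    fixpoints f = [set Some u; Some v] /\
    2 * p^* * u * v - (1 + p * p^*) * (u + v) + 2 * p = 0.
Proof.
move=> [gamma [u [v [fE [g1 gd] gu gv [t0 ->]]]]].
have le1 (l : C) (F : set_system R) : ProperFilter F -> gamma @ F --> l -> `|l| <= 1.
  move=> FF gl; rewrite normc_norm (rc_le _ 1).
  have nearF : \forall t \near F, Normc.normc (gamma t) <= 1.
    by apply: nearW => t; rewrite -rc_le -normc_norm; exact: ltW.
  exact: (@closed_cvg R C F FF gamma (fun z => Normc.normc z <= 1)
            (@closed_ball_closed R 1) nearF l gl).
exists (gamma t0), u, v; split; first by split => //; [exact: le1 gu|exact: le1 gv].
split => //.
have gu' : gamma (t0 - h) @[h --> +oo] --> u.
  apply: (cvg_comp _ _ _ gu) => A [M [Mr HM]]; exists (t0 - M); split.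
    by rewrite num_real.
  by move=> x xM; apply: HM; lra.
have gv' : gamma (t0 + h) @[h --> +oo] --> v.
  apply: (cvg_comp _ _ _ gv) => A [M [Mr HM]]; exists (M - t0); split.
    by rewrite num_real.
  by move=> x xM; apply: HM; lra.
pose p := gamma t0; rewrite -/p.
have lim : 2 * p^* * gamma (t0 - h) * gamma (t0 + h) -
     (1 + p * p^*) * (gamma (t0 - h) + gamma (t0 + h)) + 2 * p @[h --> +oo] -->
   2 * p^* * u * v - (1 + p * p^*) * (u + v) + 2 * p.
  exact: (@cvg_bilinear C R _ _ _ _ u v _ _ _ gu' gv').
apply/eqP; apply/negP => /negP /neq0_near /lim near_ne.
have [h [h0 hne]] : exists h, 0 < h /\ 2 * p^* * gamma (t0 - h) * gamma (t0 + h) -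
     (1 + p * p^*) * (gamma (t0 - h) + gamma (t0 + h)) + 2 * p != 0.
  apply: (@filter_ex _ (@pinfty_nbhs R)); apply: filterI => //.
  exact: nbhs_pinfty_gt.
move/eqP: hne; apply; apply: (hyperbolic_midpoint (g1 _) (g1 _) (g1 _) (t := h)); rewrite gd.
- by rewrite addrAC subrr add0r normrN ger0_norm// ltW.
- by rewrite addrAC subrr add0r ger0_norm// ltW.
by rewrite opprD addrACA subrr add0r -opprD normrN ger0_norm ?addr_ge0 ?ltW// mulr2n.
Qed.

End Axis.

(** * Orbits and the action of the half-turns on them *)

Lemma group_orbit_mul (T : Type) (G : set (T -> T)) (g : T -> T) (z : T) :
  is_group G -> (exists g', cancel g g' /\ cancel g' g) -> G g ->
  group_orbit G (g z) = group_orbit G z.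
Proof.
move=> [_ GM GV] [g' [gK g'K]] Gg; apply/seteqP; split=> _ [h Gh <-].
  by exists (h \o g) => //; exact: GM.
by exists (h \o g'); [apply: GM => //; exact: GV gK g'K Gg|rewrite /= gK].
Qed.

Section OrbitsOfHalfTurns.
Variables (T : Type) (E EA EB : T -> T).
Hypotheses (EK : involutive E) (EAK : involutive EA) (EBK : involutive EB).
Hypotheses (E1 : E <> idfun) (EA1 : EA <> idfun) (EB1 : EB <> idfun).
Let f := half_turns E EA EB.
Let G := generated [set E \o EA; E \o EB].

Let fI k : involutive (f k). Proof. exact: half_turnsK. Qed.

Lemma even_words_group : is_group G.
Proof.
split=> [X [[]]//|g h Gg Gh X HX|g h gh hg Gg X HX]; have [[_ GM GV] _] := HX.
  by apply: GM; [exact: Gg|exact: Gh].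
by apply: (GV g h) => //; exact: Gg.
Qed.

Let even_wordP g : G g -> exists2 w, ~~ odd (size w) & g = ev f w.
Proof. by rewrite /G (generated_even_words EK EAK EBK). Qed.

Lemma half_turn_conj k g : G (f k \o g \o f k) <-> G g.
Proof.
have imp h : G h -> G (f k \o h \o f k).
  rewrite /G (generated_even_words EK EAK EBK) => -[w ew ->].
  exists (k :: rcons w k); first by rewrite /= size_rcons /= negbK.
  by rewrite -cats1 /= ev_cat.
split=> [/imp|]; last exact: imp.
by congr G; apply/funext => z /=; rewrite !fI.
Qed.

Lemma half_turn_orbit k z : f k @` group_orbit G z = group_orbit G (f k z).
Proof.
apply/seteqP; split=> [_ [_ [g Gg <-] <-]|_ [g Gg <-]].
  by exists (f k \o g \o f k); [exact/half_turn_conj|rewrite /= fI].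
exists (f k (g (f k z))); last by rewrite fI.
by exists (f k \o g \o f k) => //; exact/half_turn_conj.
Qed.

Lemma even_word_inverse g : G g -> exists g', cancel g g' /\ cancel g' g.
Proof.
rewrite /G (generated_even_words EK EAK EBK) => -[w _ ->].
exists (ev f (word_inv id w)); split.
  by apply: ev_invK => // k; exact: fI.
by apply: ev_Kinv => // k; exact: fI.
Qed.

Lemma orbit_mul g z : G g -> group_orbit G (g z) = group_orbit G z.
Proof.
by move=> Gg; apply: group_orbit_mul => //; [exact: even_words_group|exact: even_word_inverse].
Qed.

Lemma mem_orbit z : group_orbit G z z.
Proof. by exists idfun => //; have [] := even_words_group. Qed.

Hypothesis freeG : free_rank_two G.
Variable D : set T.
Hypothesis fD : forall k z, D z -> D (f k z).
Hypothesis finite_stab : forall z, D z -> finite_set [set g | G g /\ g z = z].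

Lemma fixed_orbit z : D z -> E @` group_orbit G z = group_orbit G z ->
  exists k y, f k y = y /\ group_orbit G z = group_orbit G y.
Proof.
move=> Dz orbz; have : group_orbit G z (E z) by rewrite -orbz; exists z => //; exact: mem_orbit.
move=> [g /even_wordP[w ew gw] gz].
have : ev f (None :: w) z = z by rewrite /= -/(ev f w) -gw gz; exact: fI None z.
move=> /(odd_word_fixes EK EAK EBK E1 EA1 EB1 freeG fD finite_stab (w := None :: w)).
move=> /(_ ew Dz) [h [k [y [Gh -> ky]]]].
by exists k, y; split => //; exact: orbit_mul.
Qed.

(** If w carries y to y', then w k w^-1 k' is an even word fixing y', hence a relation; for distinct
    k and k' it would contain k an odd number of times. *)
Lemma orbit_letter k k' y y' : D y' -> f k y = y -> f k' y' = y' ->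
  group_orbit G y = group_orbit G y' -> k = k'.
Proof.
move=> Dy' ky ky' orby; have : group_orbit G y y' by rewrite orby; exact: mem_orbit.
move=> [g /even_wordP[w ew gw] gy].
apply/eqP; apply/negP => /negP kk'.
have fK i : cancel (f (id i)) (f i) by exact: fI.
have wy : ev f w y = y' by rewrite -gw.
pose W := (w ++ k :: word_inv id w) ++ [:: k'].
have szW : size W = (size w + (size w).+1 + 1)%N.
  by rewrite !size_cat /= size_rev size_map.
have Wy' : ev f W y' = y'.
  rewrite !ev_cat /= ky' -{1}wy (ev_invK (fun=> erefl) fK) ky; exact: wy.
have W1 : ev f W = idfun.
  apply: (even_word_fixes EK EAK EBK E1 EA1 EB1 freeG fD finite_stab _ Dy' Wy').
  by rewrite szW; lia.
have := relation_parity EK EAK EBK E1 EA1 EB1 freeG k W1.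
rewrite !count_cat /= eqxx count_rev map_id eq_sym (negPf kk'); lia.
Qed.

End OrbitsOfHalfTurns.

(** * Discontinuity outside the closed disc *)

Section Exterior.
Variable R : realType.
Local Notation C := (Cplx R).
Implicit Types (M N : 'M[C]_2) (G : set (sphere R -> sphere R)).

Let s := @sphere_inv R.

Definition inv_conj_mx M : 'M[C]_2 :=
  mx2 (M ord_max ord_max) (M ord_max ord0) (M ord0 ord_max) (M ord0 ord0).

Lemma det_inv_conj_mx M : \det (inv_conj_mx M) = \det M.
Proof. by rewrite !det2 !mx2E; ring. Qed.

Lemma mobius_inv_conj_mx M : \det M != 0 ->
  mobius (inv_conj_mx M) = s \o mobius M \o s.
Proof.
move=> dM; have dJ : \det (mx2 0 1 1 0 : 'M[C]_2) != 0.
  by rewrite det2 !mx2E mul0r mul1r sub0r oppr_eq0 oner_neq0.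
rewrite /s sphere_invE -mobius_comp// -mobius_comp//.
congr mobius; apply/matrixP; apply: ord2P; apply: ord2P; rewrite !mul2E !mx2E; ring.
Qed.

Lemma su11_inv_conj_mx M : su11 M -> su11 (inv_conj_mx M).
Proof.
move=> [dE cE n1]; split; rewrite !mx2E ?dE ?cE ?conjE//.
by rewrite -[RHS]n1; ring.
Qed.

Lemma inv_conj_mx_close M (e : C) : (forall i j, `|M i j - 1%:M i j| < e) ->
  forall i j, `|inv_conj_mx M i j - 1%:M i j| < e.
Proof.
move=> Me; apply: ord2P; apply: ord2P; rewrite !mx2E mxE /=.
- by have := Me ord_max ord_max; rewrite mxE.
- by have := Me ord_max ord0; rewrite mxE.
- by have := Me ord0 ord_max; rewrite mxE.
- by have := Me ord0 ord0; rewrite mxE.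
Qed.

(** Conjugation by 1/z only permutes matrix entries, so the conjugate of G satisfies the same
    hypotheses and the case of the disc applies to it. *)
Lemma exterior_sub_Omega G (z : sphere R) :
  (forall g, G g -> exists M, [/\ \det M = 1, su11 M & g = mobius M]) ->
  (forall g h, G g -> G h -> exists2 k, G k & k \o h = g) ->
  discrete G -> disc R (sphere_inv z) -> Omega G z.
Proof.
move=> GM Gdiv [e e0 dG] Dz; rewrite -(@sphere_inv_involutive R z).
apply: Omega_conj; [exact: sphere_inv_involutive|exact: sphere_inv_continuous|].
rewrite -/s; have sK : involutive s := @sphere_inv_involutive R.
have ssE (g : sphere R -> sphere R) : s \o (s \o g \o s) \o s = g.
  by apply/funext => y /=; rewrite !sK.
apply: disc_sub_Omega Dz.
- move=> g /= /GM[M [dM sM gM]]; exists (inv_conj_mx M).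
  rewrite det_inv_conj_mx mobius_inv_conj_mx ?dM ?oner_neq0// -gM ssE.
  by split => //; exact: su11_inv_conj_mx.
- move=> g h /= Gg Gh; have [k Gk kE] := Gdiv _ _ Gg Gh; exists (s \o k \o s).
    by rewrite /= ssE.
  rewrite -[RHS]ssE -kE; apply/funext => y /=; by rewrite !sK.
exists e => // M dM Me /= GM'.
have PE : mobius (inv_conj_mx M) = s \o mobius M \o s.
  by rewrite mobius_inv_conj_mx// dM oner_neq0.
have P1 : mobius (inv_conj_mx M) = idfun.
  apply: dG; [by rewrite det_inv_conj_mx|exact: inv_conj_mx_close|by rewrite PE].
by rewrite -(ssE (mobius M)) -PE P1; apply/funext => y /=; rewrite sK.
Qed.

End Exterior.

(** * The factors of A and B are half-turns *)

Section HalfTurnFactorization.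
Variable R : realType.
Local Notation C := (Cplx R).
Implicit Types (M N : 'M[C]_2) (A EA : sphere R -> sphere R) (p : sphere R).

Lemma tr0_elliptic_order_two N : \det N = 1 -> \tr N = 0 ->
  mobius N <> idfun -> elliptic_order_two (mobius N).
Proof.
move=> dN tN N1; split => //.
  by exists N; split; rewrite // tN expr0n /= lexx ltr0n.
by apply/funext => z /=; rewrite mobius_tr0_involutive// dN oner_neq0.
Qed.

(* The half-turn about a point of the axis of A exchanges the end points of the
   axis, hence so does EA; a Moebius map exchanging two points is an
   involution. *)
Lemma half_turn_factor M A EA p : \det M = 1 -> su11 M -> \tr M = 0 ->
  mobius M p = p -> axis A p -> hyperbolic A -> A = mobius M \o EA ->
  exists N, [/\ \det N = 1, \tr N = 0, EA = mobius N & EA <> idfun].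
Proof.
move=> dM sM tM Mp axp hypA AE.
have [p0 [u [v [[pE p1 u1 v1] [fE mid]]]]] := axis_midpoint axp.
have uv := hyperbolic_fixpoints hypA fE; rewrite {}pE in Mp.
have dM0 : \det M != 0 by rewrite dM oner_neq0.
have MK := mobius_tr0_involutive dM0 tM.
have Au : A (Some u) = Some u by have : fixpoints A (Some u) by rewrite fE; left.
have Av : A (Some v) = Some v by have : fixpoints A (Some v) by rewrite fE; right.
have Mu : mobius M (Some u) = Some v by exact: half_turn_swap mid.
have [MA [dMA _ MAE]] := hypA.
have EAE : EA = mobius M \o A by rewrite AE; apply/funext => z /=; rewrite MK.
have EAM : EA = mobius (M *m MA).
  by rewrite mobius_comp ?dMA ?oner_neq0// -MAE.
have EAu : EA (Some u) = Some v by rewrite EAE /= Au.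
have EAv : EA (Some v) = Some u by rewrite EAE /= Av -Mu MK.
exists (M *m MA); split => //.
- by rewrite det_mulmx dM dMA mulr1.
- by apply: (@mobius_swap_tr0 _ _ u v); rewrite -?EAM//; exact/eqP.
- by move=> EA1; apply: uv; move: EAu; rewrite EA1 => -[].
Qed.

Lemma disc_exterior (z : sphere R) : disc R z -> ~ disc R (sphere_inv z).
Proof.
case: z => [x|/disc_None//] /disc_Some x1; rewrite /sphere_inv.
case: eqP => [_ /disc_None//|/eqP x0] /disc_Some.
rewrite normfV invf_lt1 ?normr_gt0// => /(lt_trans x1); by rewrite ltxx.
Qed.

End HalfTurnFactorization.

Theorem theorem8p3 (R : realType) (A B : sphere R -> sphere R)
    (G : set (sphere R -> sphere R))
    (defG : G = generated [set A; B])
    (fuchsG : fuchsian G)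
    (freeG : free_rank_two G)
    (no_parabolic : forall g, G g -> ~ parabolic g)
    (hypA : hyperbolic A) (hypB : hyperbolic B)
    (E EA EB : sphere R -> sphere R)
    (p q pA qA pB qB : sphere R)
    (axisAp : axis A p) (axisBp : axis B p)
    (ellE : elliptic_order_two E)
    (E_disc : E @` disc R = disc R)
    (Ep : E p = p)
    (defA : A = E \o EA) (defB : B = E \o EB)
    (fixE : fixpoints E = [set p; q])
    (fixEA : fixpoints EA = [set pA; qA])
    (fixEB : fixpoints EB = [set pB; qB]) :
  [/\ elliptic_order_two EA, elliptic_order_two EB,
      [set p; q; pA; qA; pB; qB] `<=` Omega G &
      weierstrass_points G (group_orbit G @` [set p; q; pA; qA; pB; qB])].
Proof.
have [[M [dM _ EM]] E1 EE] := ellE; have [Ggrp Gmob Gdisc dscG] := fuchsG.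
have EK : involutive E by move=> z; have := congr1 (fun g => g z) EE.
have dM0 : \det M != 0 by rewrite dM oner_neq0.
have sM : su11 M by apply: disc_su11 => //; rewrite -EM.
have tM : \tr M = 0 by apply: mobius_involutive_tr0 => //; rewrite -EM.
have [NA [dNA tNA EANA EA1]] : exists N, [/\ \det N = 1, \tr N = 0, EA = mobius N & EA <> idfun].
  by apply: (half_turn_factor dM sM tM _ axisAp); rewrite -?EM.
have [NB [dNB tNB EBNB EB1]] : exists N, [/\ \det N = 1, \tr N = 0, EB = mobius N & EB <> idfun].
  by apply: (half_turn_factor dM sM tM _ axisBp); rewrite -?EM.
have ellEA : elliptic_order_two EA by rewrite EANA; apply: tr0_elliptic_order_two; rewrite -?EANA.
have ellEB : elliptic_order_two EB by rewrite EBNB; apply: tr0_elliptic_order_two; rewrite -?EBNB.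
have EAK : involutive EA by rewrite EANA; apply: mobius_tr0_involutive; rewrite // dNA oner_neq0.
have EBK : involutive EB by rewrite EBNB; apply: mobius_tr0_involutive; rewrite // dNB oner_neq0.
have GA : G A by rewrite defG => X [_ HX]; apply: HX; left.
have GB : G B by rewrite defG => X [_ HX]; apply: HX; right.
have half_disc F : G (E \o F) -> F @` disc R = disc R.
  move=> /Gdisc EF; rewrite -[RHS]E_disc -[in RHS]EF image_comp.
  by congr (_ @` _); apply/funext => z /=; rewrite EK.
have sNA : su11 NA by apply: disc_su11 => //; rewrite -EANA; apply: half_disc; rewrite -defA.
have sNB : su11 NB by apply: disc_su11 => //; rewrite -EBNB; apply: half_disc; rewrite -defB.
pose f := half_turns E EA EB.
have defG' : G = generated [set E \o EA; E \o EB] by rewrite -defA -defB.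
have freeG' : free_rank_two (generated [set E \o EA; E \o EB]) by rewrite -defG'.
have GM g : G g -> exists M, [/\ \det M = 1, su11 M & g = mobius M].
  move=> Gg; have [N [dN gN]] := is_mobius_det1 (Gmob g Gg).
  by exists N; split => //; apply: disc_su11 => //; rewrite -gN; exact: Gdisc.
have Ginv g : G g -> exists g', cancel g g' /\ cancel g' g.
  by rewrite defG'; exact: even_word_inverse.
have Gdiv g h : G g -> G h -> exists2 k, G k & k \o h = g.
  move=> Gg Gh; have [h' [hK h'K]] := Ginv h Gh; have [_ GMul GV] := Ggrp.
  exists (g \o h'); first by apply: GMul => //; exact: GV hK h'K Gh.
  by apply/funext => z /=; rewrite hK.
have OmegaD z : disc R z -> Omega G z by exact: (disc_sub_Omega GM Gdiv dscG).
have OmegaX z : disc R (sphere_inv z) -> Omega G z by exact: exterior_sub_Omega.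
have fcont k : continuous (f k).
  by case: k => [[]|]; rewrite /f /= ?EANA ?EBNB ?EM; apply: mobius_continuous;
     rewrite ?dNA ?dNB ?dM oner_neq0.
have fOmega k z : Omega G z -> Omega G (f k z).
  move=> Oz; apply: Omega_conj; [exact: half_turnsK|exact: fcont|].
  rewrite (_ : [set _ | _] = G)//; apply/seteqP; split=> g /=; rewrite defG'.
    exact: (iffLR (half_turn_conj EK EAK EBK k g)).
  exact: (iffRL (half_turn_conj EK EAK EBK k g)).
have stab := @Omega_finite_stab R G.
have fixf : [/\ fixpoints (f None) = [set p; q], fixpoints (f (Some true)) = [set pA; qA] &
  fixpoints (f (Some false)) = [set pB; qB]] by [].
have sideE : disc R p /\ disc R (sphere_inv q) \/ disc R (sphere_inv p) /\ disc R q.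
  by apply: (su11_tr0_fixpoints dM sM tM); rewrite -EM.
have sideA : disc R pA /\ disc R (sphere_inv qA) \/ disc R (sphere_inv pA) /\ disc R qA.
  by apply: (su11_tr0_fixpoints dNA sNA tNA); rewrite -EANA.
have sideB : disc R pB /\ disc R (sphere_inv qB) \/ disc R (sphere_inv pB) /\ disc R qB.
  by apply: (su11_tr0_fixpoints dNB sNB tNB); rewrite -EBNB.
have sub : [set p; q; pA; qA; pB; qB] `<=` Omega G.
  move=> z [[[[[->|->]|->]|->]|->]|->];
  [case: sideE|case: sideE|case: sideA|case: sideA|case: sideB|case: sideB];
  by move=> [? ?]; auto.
(* The image under [E] of an orbit of [G] is again an orbit, as [E] normalizes [G]. *)
pose J (o : set (sphere R)) := E @` o.
have six k y : f k y = y -> [set p; q; pA; qA; pB; qB] y.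
  case: k => [[]|] fy.
  - have : fixpoints EA y := fy.
    by rewrite fixEA => -[->|->]; [left; left; left; right|left; left; right].
  - have : fixpoints EB y := fy.
    by rewrite fixEB => -[->|->]; [left; right|right].
  - have : fixpoints E y := fy.
    by rewrite fixE => -[->|->]; [do 5 left|do 4 left; right].
have Eq : f None q = q by have : fixpoints E q by rewrite fixE; right.
have EApA : f (Some true) pA = pA by have : fixpoints EA pA by rewrite fixEA; left.
have EAqA : f (Some true) qA = qA by have : fixpoints EA qA by rewrite fixEA; right.
have EBpB : f (Some false) pB = pB by have : fixpoints EB pB by rewrite fixEB; left.
have EBqB : f (Some false) qB = qB by have : fixpoints EB qB by rewrite fixEB; right.
have {}Ep : f None p = p := Ep.
have fixed y : [set p; q; pA; qA; pB; qB] y -> exists k, f k y = y.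
  by move=> [[[[[->|->]|->]|->]|->]|->]; [exists None|exists None|exists (Some true)|
    exists (Some true)|exists (Some false)|exists (Some false)].
have orbJ z : J (group_orbit G z) = group_orbit G (E z).
  by rewrite defG'; exact: (half_turn_orbit EK EAK EBK None).
have WE : group_orbit G @` [set p; q; pA; qA; pB; qB] = surface_fixpoints G J.
  apply/seteqP; split=> [_ [y y6 <-]|_ [[z Oz <-]] Jz].
    split; first by exists y => //; exact: sub.
    have [k ky] := fixed y y6; rewrite /fixpoints /= orbJ.
    (* The product of [E] with any half-turn is [A], [B] or the identity, so all three half-turns
       induce the same map on orbits. *)
    have -> : E y = (E \o f k) y by rewrite /= ky.
    rewrite defG'; apply: orbit_mul => //; rewrite -defG'.
    case: (k) => [[]|]; [by move: GA; rewrite defA|by move: GB; rewrite defB|].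
    by rewrite (_ : E \o f None = idfun); [case: Ggrp|exact/funext].
  rewrite defG' in Oz Jz stab fOmega *.
  have [k [y [ky ->]]] := fixed_orbit EK EAK EBK E1 EA1 EB1 freeG' fOmega stab Oz Jz.
  by exists y => //; exact: six ky.
split => //.
suff hypJ : hyperelliptic_involution G J by exact: (ex_intro2 _ _ J hypJ WE).
split; last first.
  rewrite -WE.
  have disc_orbit y y' : group_orbit G y = group_orbit G y' -> disc R y' -> disc R y.
    move=> e Dy'; have [g Gg <-] : group_orbit G y' y by rewrite -e defG'; exact: mem_orbit.
    by rewrite -(Gdisc g Gg); exists y'.
  have opposite y y' : disc R y /\ disc R (sphere_inv y') \/
      disc R (sphere_inv y) /\ disc R y' -> group_orbit G y <> group_orbit G y'.
    move=> [[yD y'X] e|[yX y'D] /disc_orbit/(_ y'D)/disc_exterior//].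
    by apply: (disc_exterior _ y'X); exact: disc_orbit (esym e) yD.
  pose pt := nth p [:: p; q; pA; qA; pB; qB].
  pose letter_of := nth None [:: None; None; Some true; Some true; Some false; Some false].
  have pt_fixed n : (n < 6)%N -> f (letter_of n) (pt n) = pt n.
    by move: n => [|[|[|[|[|[|//]]]]]].
  have pt_Omega n : (n < 6)%N -> Omega G (pt n).
    by move: n => [|[|[|[|[|[|//]]]]]] _; apply: sub; rewrite /pt /=;
      [do 5 left|do 4 left; right|left; left; left; right|left; left; right|left; right|right].
  have -> : [set p; q; pA; qA; pB; qB] = pt @` `I_6.
    apply/seteqP; split=> [y [[[[[->|->]|->]|->]|->]|->]|_ [n n6 <-]].
    - by exists 0%N.
    - by exists 1%N.
    - by exists 2%N.
    - by exists 3%N.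
    - by exists 4%N.
    - by exists 5%N.
    exact: six (pt_fixed n n6).
  rewrite image_comp; apply: inj_card_eq => n m; rewrite !inE => n6 m6 /= e.
  (* Equal orbits come from the same half-turn; only its two fixed points remain, and [opposite]
     separates them. *)
  have e' : letter_of n = letter_of m.
    rewrite defG' in e pt_Omega stab fOmega *.
    exact: (orbit_letter EK EAK EBK E1 EA1 EB1 freeG' fOmega stab
      (pt_Omega m m6) (pt_fixed n n6) (pt_fixed m m6) e).
  move: n m n6 m6 e e' => [|[|[|[|[|[|//]]]]]] [|[|[|[|[|[|//]]]]]] _ _ e // _.
  - by case: (opposite _ _ sideE e).
  - by case: (opposite _ _ sideE (esym e)).
  - by case: (opposite _ _ sideA e).
  - by case: (opposite _ _ sideA (esym e)).
  - by case: (opposite _ _ sideB e).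
  - by case: (opposite _ _ sideB (esym e)).
split.
- by move=> _ [z Oz <-]; rewrite orbJ; exists (E z) => //; exact: (fOmega None).
- by move=> o _; rewrite /J image_comp EE image_id.
(* [E] itself is a global lift of [J]. *)
move=> z Oz; exists (Omega G), E; split.
- by split => //; exact: Omega_open.
- by [].
- by move=> _ [w Ow <-]; exact: (fOmega None).
- by move=> w _; rewrite EM; exact: mobius_holomorphic.
- by move=> w _; exact: orbJ.
Qed.
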